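(* Let $f:\mathbb{R}^n\to\mathbb{R}$ be $\mu$-strongly convex ($\mu>0$) and $L$-smooth, with stochastic gradients satisfying $\mathbb{E}_\xi[\nabla f(x,\xi)]=\nabla f(x)$ and $\mathbb{E}_\xi[\|\nabla f(x,\xi)-\nabla f(x)\|_2^2]\le\sigma^2$ for all $x\in\mathbb{R}^n$. Let $x^*$ be the minimizer of $f$ and $r_0=f(x^0)-f(x^* )>0$. Then for all $\beta\in(0,1)$ and $N\ge1$ such that $\ln\frac{4N}{\beta}\ge2$, after $N$ iterations of clipped-SGD started at $x^0$ with stepsize, clipping levels and batchsizes $$\gamma=\frac{1}{81L\ln\frac{4N}{\beta}},\qquad\lambda_k=4\sqrt{L(1-\gamma\mu)^kr_0},\qquad m_k=\left\lceil\max\left\{1,\frac{27N\sigma^2}{16Lr_0(1-\gamma\mu)^k\ln\frac{4N}{\beta}}\right\}\right\rceil,$$ we have, with probability at least $1-\beta$, $$f(x^N)-f(x^* )\le2(1-\gamma\mu)^N\left(f(x^0)-f(x^* )\right).$$ In other words, the method achieves $f(x^N)-f(x^* )\le\varepsilon$ with probability at least $1-\beta$ after $$O\left(\frac L\mu\ln\left(\frac{r_0}{\varepsilon}\right)\ln\left(\frac{L}{\mu\beta}\ln\frac{r_0}{\varepsilon}\right)\right)$$ iterations (i.e. for a suitable $N$ of this order) and requires $$O\left(\max\left\{\frac L\mu,\frac{\sigma^2}{\mu\varepsilon}\cdot\frac L\mu\right\}\ln\left(\frac{r_0}{\varepsilon}\right)\ln\left(\frac{L}{\mu\beta}\ln\frac{r_0}{\varepsilon}\right)\right)$$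 oracle calls.
   Context: Problem: minimize $f(x)=\mathbb{E}_\xi[f(x,\xi)]$ over $x\in\mathbb{R}^n$. $f$ is accessed only through stochastic gradients $\nabla f(x,\xi)$; $\sigma\ge0$; nothing is assumed about their distribution beyond unbiasedness and variance at most $\sigma^2$. One oracle call is one sample of $\nabla f(x,\xi)$. $f$ is $L$-smooth ($L>0$) if it is differentiable and $\|\nabla f(x)-\nabla f(y)\|_2\le L\|x-y\|_2$ for all $x,y$. A differentiable $f$ is $\mu$-strongly convex if $f(x)\ge f(y)+\langle\nabla f(y),x-y\rangle+\frac\mu2\|x-y\|_2^2$ for all $x,y$. Clipping: $\mathrm{clip}(g,\lambda)=\min\{1,\lambda/\|g\|_2\}\,g$ (and $\mathrm{clip}(0,\lambda)=0$). Algorithm clipped-SGD (with iteration-dependent clipping level). Inputs: deterministic starting point $x^0$, number of iterations $N$, batchsizes $m_0,\dots,m_{N-1}$ (positive integers), stepsize $\gamma>0$, clipping levels $\lambda_0,\dots,\lambda_{N-1}>0$. For $k=0,\dots,N-1$: draw fresh i.i.d. samples $\xi_1^k,\dots,\xi_{m_k}^k$ (independent of the past) and compute $\nabla f(x^k,\boldsymbol{\xi}^k)=\frac1{m_k}\sum_{i=1}^{m_k}\nabla f(x^k,\xi_i^k)$; compute $\widetilde\nabla f(x^k,\boldsymbol{\xi}^k)=\mathrm{clip}(\nabla f(x^k,\boldsymbol{\xi}^k),\lambda_k)$; set $x^{k+1}=x^k-\gamma\widetilde\nabla f(x^k,\boldsymbol{\xi}^k)$. $O(\cdot)$ hides absolute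 numerical constants; complexity bounds are for target accuracies $0<\varepsilon\le e^{-2}r_0$. *)

(* Defs.v *)
From HB Require Import structures.
From mathcomp Require Export all_boot all_order all_algebra.
From mathcomp Require Export all_classical all_reals all_analysis.
Export Order.TTheory GRing.Theory Num.Theory numFieldNormedType.Exports.

Set Implicit Arguments.
Unset Strict Implicit.
Unset Printing Implicit Defensive.

Local Open Scope classical_set_scope.
Local Open Scope ring_scope.

Section euclidean.
Context {R : realType} {n : nat}.
Implicit Types (u v x y : 'rV[R]_n) (f : 'rV[R]_n -> R).

Definition dotv u v : R := \sum_(i < n) u 0 i * v 0 i.

(* The norm `|u| that the library puts on 'rV[R]_n is the sup norm. *)
Definition norm2 u : R := Num.sqrt (dotv u u).

(* Meaningful only where f is differentiable. *)
Definition grad f x : 'rV[R]_n := \row_i 'D_(delta_mx 0 i) f x.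

Definition smooth (L : R) f :=
  (forall x, differentiable f x) /\
  (forall x y, norm2 (grad f x - grad f y) <= L * norm2 (x - y)).

Definition strongly_convex (mu : R) f :=
  (forall x, differentiable f x) /\
  (forall x y,
    f x >= f y + dotv (grad f y) (x - y) + mu / 2 * norm2 (x - y) ^+ 2).

(* As 0^-1 = 0, this gives clip 0 lambda = 0. *)
Definition clip (g : 'rV[R]_n) (lambda : R) : 'rV[R]_n :=
  Num.min 1 (lambda / norm2 g) *: g.

(* D is the law of xi and G x s the stochastic gradient at x for the sample s.
   G is jointly measurable for the product sigma-algebra of R^n, which the
   library defines on tuples, not on matrices; it is the Borel one.
   A finite value of 'E_D[_] entails integrability: the integral of a
   measurable function is the difference of those of its positive and negative
   parts, and +oo - +oo is infinite. *)
Definition stochastic_gradient d (Xi : measurableType d)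
    (D : probability Xi R) (sigma : R) f (G : 'rV[R]_n -> Xi -> 'rV[R]_n) :=
  [/\ forall j, measurable_fun [set: n.-tuple R * Xi]
        (fun z => G (\row_i tnth z.1 i) z.2 0 j),
      forall x j, ('E_D[fun s => G x s 0%R j] = (grad f x 0%R j)%:E)%E &
      forall x, ('E_D[fun s => (norm2 (G x s - grad f x) ^+ 2)%R]
                 <= (sigma ^+ 2)%:E)%E].

End euclidean.

Section sampling.
Context {R : realType} {d dO : measure_display}.
Context {Xi : measurableType d} {Omega : measurableType dO}.

Definition mutually_independent {I : eqType} (P : probability Omega R)
    (S : set I) (X : I -> Omega -> Xi) :=
  forall (J : seq I) (A : I -> set Xi), uniq J ->
    (forall i, i \in J -> S i) -> (forall i, measurable (A i)) ->
    P [set w | forall i, i \in J -> A i (X i w)] =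
    (\prod_(i <- J) P (X i @^-1` A i))%E.

(* xi (k, i) is the i-th sample of iteration k; indices with N <= k or m k <= i
   are not used by the algorithm and are unconstrained. *)
Definition iid_samples (P : probability Omega R) (D : probability Xi R)
    (N : nat) (m : nat -> nat) (xi : nat * nat -> Omega -> Xi) :=
  let S := [set ki : nat * nat | (ki.1 < N)%N /\ (ki.2 < m ki.1)%N] in
  [/\ forall ki, S ki -> measurable_fun setT (xi ki),
      forall ki, S ki ->
        forall A, measurable A -> P (xi ki @^-1` A) = D A &
      mutually_independent P S xi].

End sampling.

Section clipped_sgd.
Context {R : realType} {n : nat}.

Section algorithm.
Context {d dO : measure_display}.
Context {Xi : measurableType d} {Omega : measurableType dO}.
Variables (G : 'rV[R]_n -> Xi -> 'rV[R]_n) (x0 : 'rV[R]_n).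
Variables (gamma : R) (lambda : nat -> R) (m : nat -> nat).
Variable xi : nat * nat -> Omega -> Xi.

Definition minibatch_grad (k : nat) (x : 'rV[R]_n) (w : Omega) : 'rV[R]_n :=
  (m k)%:R^-1 *: \sum_(i < m k) G x (xi (k, val i) w).

Fixpoint clipped_sgd (k : nat) (w : Omega) : 'rV[R]_n :=
  if k is k'.+1 then
    let x := clipped_sgd k' w in
    x - gamma *: clip (minibatch_grad k' x w) (lambda k')
  else x0.

End algorithm.

(* Whatever probability space carries the samples, the last iterate of an
   N-iteration run lies in E with probability at least p. *)
Definition clipped_sgd_reaches d (Xi : measurableType d) (D : probability Xi R)
    (G : 'rV[R]_n -> Xi -> 'rV[R]_n) (x0 : 'rV[R]_n) (gamma : R)
    (lambda : nat -> R) (m : nat -> nat) (N : nat) (p : R)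
    (E : set 'rV[R]_n) :=
  forall (dO : measure_display) (Omega : measurableType dO)
    (P : probability Omega R) (xi : nat * nat -> Omega -> Xi),
    iid_samples P D N m xi ->
    (P [set w | E (clipped_sgd G x0 gamma lambda m xi N w)] >= p%:E)%E.

End clipped_sgd.

Section parameters.
Context {R : realType}.
Variables (L mu sigma r0 beta : R) (N : nat).

Definition logfactor : R := ln (4 * N%:R / beta).

Definition stepsize : R := (81 * L * logfactor)^-1.

Definition clip_level (k : nat) : R :=
  4 * Num.sqrt (L * (1 - stepsize * mu) ^+ k * r0).

Definition batchsize (k : nat) : nat :=
  absz (Num.ceil (Num.max 1 (27 * N%:R * sigma ^+ 2 /
    (16 * L * r0 * (1 - stepsize * mu) ^+ k * logfactor)))).

End parameters.

(* Main.v *)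
Require Import Defs.
From HB Require Import structures.
From mathcomp Require Import measurable_realfun ring lra.

Set Implicit Arguments.
Unset Strict Implicit.
Unset Printing Implicit Defensive.

Local Open Scope classical_set_scope.
Local Open Scope ring_scope.

(* Measure the gap at iteration k in units of (1 - gamma mu)^k r0, writing rho_k
   for the result, so that rho_0 = 1. While rho_k <= 2, smoothness bounds
   |grad f(x_k)| by lambda_k / 2; hence clipping brings the minibatch gradient no
   further from grad f(x_k), and it creates a bias that is only quadratic in the
   noise. As rho_(k+1) - rho_k is then at most of order 1 / ell, with
   ell = ln (4 N / beta), expanding the exponential to second order yields
   E[exp (2 ell rho_(k+1)) | x_k] <= exp (2 ell rho_k) (1 + ell / (9 N)),
   the first-order term being centred. Stopping rho when it exceeds 2, this gives
   E[exp (2 ell U_N)] <= exp (2 ell + ell / 9) for the stopped process U, and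
   Markov's inequality bounds P (U_N > 2) by exp (- ell) = beta / (4 N).
   Conditioning on x_k is replaced by Tonelli's theorem: past and fresh samples
   generate independent sigma-algebras, so that in an integral over w the two
   occurrences of w can be decoupled. *)

(** * The Euclidean norm, the inner product and the clipping map *)

Section euclidean_space.
Context {R : realType} {n : nat}.
Implicit Types (u v w x y : 'rV[R]_n) (a : R).

Lemma dotvC u v : dotv u v = dotv v u.
Proof. by apply: eq_bigr => i _; rewrite mulrC. Qed.

Lemma dotvDl u v w : dotv (u + v) w = dotv u w + dotv v w.
Proof. by rewrite -big_split; apply: eq_bigr => i _; rewrite mxE mulrDl. Qed.

Lemma dotvZl a u w : dotv (a *: u) w = a * dotv u w.
Proof. by rewrite mulr_sumr; apply: eq_bigr => i _; rewrite mxE mulrA. Qed.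

Lemma dotvNl u w : dotv (- u) w = - dotv u w.
Proof. by rewrite -scaleN1r dotvZl mulN1r. Qed.

Lemma dotvBl u v w : dotv (u - v) w = dotv u w - dotv v w.
Proof. by rewrite dotvDl dotvNl. Qed.

Lemma dotvDr u v w : dotv w (u + v) = dotv w u + dotv w v.
Proof. by rewrite ![dotv w _]dotvC dotvDl. Qed.

Lemma dotvZr a u w : dotv w (a *: u) = a * dotv w u.
Proof. by rewrite ![dotv w _]dotvC dotvZl. Qed.

Lemma dotvNr u w : dotv w (- u) = - dotv w u.
Proof. by rewrite ![dotv w _]dotvC dotvNl. Qed.

Lemma dotvBr u v w : dotv w (u - v) = dotv w u - dotv w v.
Proof. by rewrite dotvDr dotvNr. Qed.

Definition dotvE := (dotvDl, dotvDr, dotvNl, dotvNr, dotvZl, dotvZr).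

Lemma dotvv_ge0 u : 0 <= dotv u u.
Proof. by apply: sumr_ge0 => i _; rewrite -expr2 sqr_ge0. Qed.

Lemma norm2_ge0 u : 0 <= norm2 u.
Proof. exact: sqrtr_ge0. Qed.

Lemma sqr_norm2 u : norm2 u ^+ 2 = dotv u u.
Proof. by rewrite sqr_sqrtr// dotvv_ge0. Qed.

Lemma norm2Z a u : 0 <= a -> norm2 (a *: u) = a * norm2 u.
Proof.
move=> a0; apply/eqP; rewrite -(@eqrXn2 _ 2)// ?mulr_ge0 ?norm2_ge0//.
by rewrite exprMn !sqr_norm2 !dotvE mulrA.
Qed.

Lemma norm2_eq0 u : norm2 u = 0 -> u = 0.
Proof.
move=> u0; apply/rowP => i; have /eqP := sqr_norm2 u.
rewrite u0 expr0n/= eq_sym psumr_eq0 => [|j _]; last by rewrite -expr2 sqr_ge0.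
move/allP/(_ i); rewrite mem_index_enum mulf_eq0 orbb => /(_ isT)/eqP ->.
by rewrite mxE.
Qed.

Lemma dot0v u : dotv 0 u = 0.
Proof. by rewrite -(scale0r 0) dotvZl mul0r. Qed.

Lemma dotv0 u : dotv u 0 = 0.
Proof. by rewrite dotvC dot0v. Qed.

Lemma norm2D_sqr u v :
  norm2 (u + v) ^+ 2 = norm2 u ^+ 2 + 2 * dotv u v + norm2 v ^+ 2.
Proof. by rewrite !sqr_norm2 !dotvE (dotvC v u); ring. Qed.

Lemma Cauchy_Schwarz u v : dotv u v <= norm2 u * norm2 v.
Proof.
have [/norm2_eq0 ->|v0] := eqVneq (norm2 v) 0.
  by rewrite dotv0 mulr_ge0 ?norm2_ge0.
have [/norm2_eq0 ->|u0] := eqVneq (norm2 u) 0.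
  by rewrite dot0v mulr_ge0 ?norm2_ge0.
have up : 0 < norm2 u by rewrite lt0r u0 norm2_ge0.
have vp : 0 < norm2 v by rewrite lt0r v0 norm2_ge0.
have := dotvv_ge0 (norm2 v *: u - norm2 u *: v).
rewrite !dotvE (dotvC v u) -!sqr_norm2.
set a := norm2 u in up *; set b := norm2 v in vp *; set c := dotv u v.
rewrite [X in 0 <= X](_ : _ = 2 * (a * b) * (a * b - c)); last by ring.
by rewrite pmulr_rge0 ?subr_ge0// !mulr_gt0.
Qed.

Lemma norm_dotv_le u v : `|dotv u v| <= norm2 u * norm2 v.
Proof.
rewrite ler_norml Cauchy_Schwarz andbT lerNl -dotvNl.
apply: le_trans (Cauchy_Schwarz _ _) _.
by rewrite /norm2 dotvNl dotvNr opprK.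
Qed.

Lemma norm2B_le u v : norm2 (u - v) <= norm2 u + norm2 v.
Proof.
rewrite -(@ler_pXn2r _ 2) ?nnegrE ?addr_ge0 ?norm2_ge0//.
rewrite sqr_norm2 !dotvE (dotvC v u) -!sqr_norm2.
have := norm_dotv_le u v; rewrite ler_norml => /andP[+ _]; nra.
Qed.

Lemma clip_id (g : 'rV[R]_n) lambda : norm2 g <= lambda -> clip g lambda = g.
Proof.
have [/norm2_eq0 ->|g0] := eqVneq (norm2 g) 0; first by rewrite /clip scaler0.
move=> gl; rewrite /clip min_l ?scale1r//.
by rewrite ler_pdivlMr ?mul1r// lt0r g0 norm2_ge0.
Qed.

Lemma clipE (g : 'rV[R]_n) lambda : 0 < lambda -> lambda < norm2 g ->
  clip g lambda = (lambda / norm2 g) *: g.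
Proof.
move=> l0 gl; rewrite /clip min_r// ler_pdivrMr ?mul1r ?ltW//.
exact: lt_trans gl.
Qed.

Lemma norm2_clip (g : 'rV[R]_n) lambda : 0 < lambda ->
  norm2 (clip g lambda) <= lambda.
Proof.
move=> l0; have [gl|lg] := leP (norm2 g) lambda; first by rewrite clip_id.
have g0 := lt_trans l0 lg.
rewrite clipE// norm2Z ?divfK ?gt_eqF ?lexx//.
by rewrite divr_ge0 ?ltW.
Qed.

(** [clip] projects onto a ball that contains [v], so it cannot increase the distance to [v]. When
    [g] is cut, the difference of the squared distances factors, and its sign follows from
    Cauchy-Schwarz and [norm2 v <= lambda / 2]. *)
Lemma clip_near (g v : 'rV[R]_n) lambda : 0 < lambda ->
  norm2 v <= lambda / 2 ->
  norm2 (clip g lambda - v) <= norm2 (g - v).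
Proof.
move=> l0 vl; have [gl|lg] := leP (norm2 g) lambda; first by rewrite clip_id.
have g0 := lt_trans l0 lg.
rewrite clipE// -(@ler_pXn2r _ 2) ?nnegrE ?norm2_ge0// !sqr_norm2 !dotvE.
rewrite (dotvC v g) -!sqr_norm2 -subr_ge0.
have := le_trans (Cauchy_Schwarz g v) (ler_wpM2l (norm2_ge0 _) vl).
set a := norm2 g in lg g0 *; set c := dotv g v; set b := norm2 v => cl.
rewrite [X in 0 <= X](_ : _ = (1 - lambda / a) *
  (a ^+ 2 + lambda * a - 2 * c)); last by field; rewrite gt_eqF.
rewrite mulr_ge0// ?subr_ge0 ?ler_pdivrMr ?mul1r ?ltW//.
have : 0 <= a * a by rewrite mulr_ge0// ltW.
move: cl; rewrite expr2; nra.
Qed.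

(* The bias of clipping is quadratic in the noise: what is cut off is
   |g| - lambda, and (s - lambda / 2) * lambda / 2 <= s ^ 2 / 4 with
   s := |g - v| >= |g| - lambda / 2. *)
Lemma clip_bias (g v : 'rV[R]_n) lambda : 0 < lambda ->
  norm2 v <= lambda / 2 ->
  dotv v (g - clip g lambda) <= norm2 (g - v) ^+ 2 / 4.
Proof.
move=> l0 vl; have [gl|lg] := leP (norm2 g) lambda.
  by rewrite clip_id// subrr dotv0 divr_ge0// sqr_ge0.
have g0 := lt_trans l0 lg.
rewrite clipE// -{1}(scale1r g) -scalerBl dotvZr.
have := le_trans (Cauchy_Schwarz g v) (ler_wpM2l (norm2_ge0 g) vl).
rewrite (sqr_norm2 (g - v)) !dotvE (dotvC v g) -!sqr_norm2.
have := Cauchy_Schwarz g v; have := norm2_ge0 v.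
set a := norm2 g in lg g0 *; set c := dotv g v.
set b := norm2 v in vl * => b0 cab cl.
apply: (@le_trans _ _ ((a - lambda) * (lambda / 2))).
  have -> : a - lambda = (1 - lambda / a) * a by field; rewrite gt_eqF.
  by rewrite -mulrA ler_wpM2l// subr_ge0 ler_pdivrMr ?mul1r ?ltW.
have h1 : (a - lambda / 2) ^+ 2 <= (a - b) ^+ 2.
  by rewrite ler_pXn2r// ?nnegrE; lra.
(* At s = a - lambda / 2, the gap s ^ 2 / 4 - (s - lambda / 2) * lambda / 2 is a quarter of this
   square. *)
have h2 : 0 <= (a - 3 / 2 * lambda) ^+ 2 by rewrite sqr_ge0.
by move: h1 h2 cab; rewrite !expr2; nra.
Qed.

End euclidean_space.

(** * Smoothness and strong convexity: the descent and Polyak-Lojasiewicz inequalities *)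

Section smooth_functions.
Context {R : realType} {n : nat}.
Implicit Types (f : 'rV[R]_n -> R) (x y h : 'rV[R]_n).

Lemma derive_grad f x h : differentiable f x -> 'D_h f x = dotv (grad f x) h.
Proof.
move=> df; rewrite deriveE// {1}(row_sum_delta h) linear_sum.
apply: eq_bigr => i _.
by rewrite linearZ/= -deriveE// mxE mulrC.
Qed.

(** The difference quotients at [t] of the restriction to the line are exactly those of [f] at
    [x + t *: h] along [h]. *)
Lemma is_derive_line f x h (t : R) : differentiable f (x + t *: h) ->
  is_derive t 1 (fun s => f (x + s *: h)) (dotv (grad f (x + t *: h)) h).
Proof.
move=> df; have E : (fun s : R => s^-1 *:
      (((fun s => f (x + s *: h)) \o shift t) (s *: 1) - f (x + t *: h))) =
    (fun s => s^-1 *: ((f \o shift (x + t *: h)) (s *: h) - f (x + t *: h))).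
  apply/funext => s /=; congr (_ *: (f _ - _)).
  by rewrite [s *: 1]mulr1 scalerDl addrCA addrA addrC addrA.
split; first by rewrite /derivable E; exact: diff_derivable.
by rewrite -derive_grad// /derive E.
Qed.

(** On the segment, [psi] is [f] minus its linear and quadratic upper terms. Its derivative is
    nonpositive on [0, 1] because the gradient is Lipschitz, and the mean value theorem compares the
    endpoints. *)
Lemma descent L f x y : smooth L f ->
  f y <= f x + dotv (grad f x) (y - x) + L / 2 * norm2 (y - x) ^+ 2.
Proof.
move=> [df lip]; set h := y - x.
pose psi t := f (x + t *: h) - t * dotv (grad f x) h
  - t ^+ 2 * (L / 2 * norm2 h ^+ 2).
have dpsi (t : R) : is_derive t 1 psi (dotv (grad f (x + t *: h)) h
    - dotv (grad f x) h - t * (L * norm2 h ^+ 2)).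
  have d1 := is_derive_line (df (x + t *: h)).
  rewrite /psi; apply: is_derive_eq.
  rewrite !scaler0 add0r /GRing.scale /= !mulr1.
  by field.
have cpsi : {within `[0, 1], continuous psi}.
  apply: continuous_subspaceT => s; have ds := dpsi s.
  by apply: differentiable_continuous; apply/derivable1_diffP; exact: ex_derive.
have [t t01] := MVT_segment ler01 (fun t _ => dpsi t) cpsi.
move: t01; rewrite in_itv/= => /andP[t0 t1].
rewrite subr0 mulr1 /psi scale1r scale0r addr0 subrKC => E.
have : dotv (grad f (x + t *: h) - grad f x) h <= t * (L * norm2 h ^+ 2).
  apply: le_trans (Cauchy_Schwarz _ _) _.
  apply: le_trans (ler_wpM2r (norm2_ge0 _) (lip _ _)) _.
  by rewrite addrC addKr norm2Z// expr2 mulrCA !mulrA.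
move: E; rewrite dotvBl; nra.
Qed.

(** A gradient step of length 1 / L lowers [f] by at least |grad f x|^2 / (2 L), yet cannot go below
    the minimum. *)
Lemma sqr_grad_le L f xs x : 0 < L -> smooth L f -> (forall y, f xs <= f y) ->
  norm2 (grad f x) ^+ 2 <= 2 * L * (f x - f xs).
Proof.
move=> L0 sm mn.
have := le_trans (mn _) (descent x (x - L^-1 *: grad f x) sm).
rewrite [_ - x]addrAC subrr sub0r !sqr_norm2 !dotvE => h.
have := ler_wpM2l (ltW L0) h.
rewrite [X in _ <= X -> _](_ : _ =
    L * f x - dotv (grad f x) (grad f x) / 2); last first.
  by field; rewrite gt_eqF.
lra.
Qed.

(** Complete the square in the strong convexity bound: with d = xs - x, the square of mu d + grad f
    x is nonnegative. *)
Lemma Polyak_Lojasiewicz mu f xs x : 0 < mu -> strongly_convex mu f ->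
  2 * mu * (f x - f xs) <= norm2 (grad f x) ^+ 2.
Proof.
move=> mu0 [_ /(_ xs x)]; move: (xs - x) => d.
move: (dotvv_ge0 (mu *: d + grad f x)).
rewrite !sqr_norm2 [dotv (_ *: _ + _) _]dotvDl !(dotvDr, dotvZl, dotvZr).
rewrite (dotvC d (grad f x)) => h0 /(ler_wpM2l (ltW mu0)); lra.
Qed.

(** The lower and upper bounds on |grad f x|^2 are both multiples of the gap, which is positive and
    can be cancelled. This is what later keeps gamma mu below 1 / 162. *)
Lemma modulus_le_smoothness mu L f xs x : 0 < mu -> 0 < L ->
  strongly_convex mu f -> smooth L f -> (forall y, f xs <= f y) ->
  0 < f x - f xs -> mu <= L.
Proof.
move=> mu0 L0 sc sm mn r0.
have := le_trans (Polyak_Lojasiewicz xs x mu0 sc) (sqr_grad_le x L0 sm mn).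
by rewrite ler_pM2r// ler_pM2l.
Qed.

Lemma smooth_continuous L f : smooth L f -> continuous f.
Proof. by move=> [df _] x; exact: differentiable_continuous. Qed.

End smooth_functions.

(** From exp (- t) >= 1 - t one gets exp t * (1 - t) <= 1, while (1 + t + 2 t^2) (1 - t) = 1 + t^2
    (1 - 2 t) is at least 1. *)
Lemma expR_le_quadratic {R : realType} (t : R) :
  t <= 1 / 2 -> expR t <= 1 + t + 2 * t ^+ 2.
Proof.
move=> t2; have h := expR_ge1Dx (- t).
have e0 := expR_gt0 t.
have e1 : expR t * expR (- t) = 1 by rewrite -expRD subrr expR0.
have h1 : expR t * (1 - t) <= 1 by rewrite -[leRHS]e1; apply: ler_wpM2l => //; exact: ltW.
have p0 : 0 < 1 - t by lra.
rewrite -(ler_pM2r p0); apply: le_trans h1 _.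
have : 0 <= t ^+ 2 * (1 - 2 * t) by rewrite mulr_ge0 ?sqr_ge0//; lra.
rewrite expr2; nra.
Qed.

(** * One clipped step, pathwise and under the exponential *)

Section clipped_step.
Context {R : realType} {n : nat}.

(** Write u = v + th with v the gradient. Descent with |v + th|^2 <= 2 |v|^2 + 2 |th|^2 and L gamma
    <= 1 / 2 leaves - gamma / 2 |v|^2, which the Polyak-Lojasiewicz inequality turns into the
    contraction factor. *)
Lemma perturbed_gradient_step (f : 'rV[R]_n -> R) (mu L gamma : R)
    (xs x u : 'rV[R]_n) :
  0 < mu -> 0 < L -> strongly_convex mu f -> smooth L f ->
  0 < gamma -> L * gamma <= 1 / 2 ->
  f (x - gamma *: u) - f xs <= (1 - gamma * mu) * (f x - f xs)
    + gamma * (L * gamma * norm2 (u - grad f x) ^+ 2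
               - dotv (grad f x) (u - grad f x)).
Proof.
move=> mu0 L0 sc sm g0 Lg; have := descent x (x - gamma *: u) sm.
have := Polyak_Lojasiewicz xs x mu0 sc.
rewrite [_ - x]addrAC subrr sub0r.
move: (grad f x) => v pl.
have [th ->] : exists th, u = th + v by exists (u - v); rewrite subrK.
rewrite addrK.
have := dotvv_ge0 (th - v); have := dotvv_ge0 v.
rewrite !sqr_norm2 in pl *; rewrite !dotvE (dotvC th v).
have h0 : 0 <= L * gamma ^+ 2 by rewrite mulr_ge0 ?sqr_ge0 ?ltW.
move=> v0 /(ler_wpM2l h0).
have h2 := ler_wpM2l (ltW g0) pl.
have := ler_wpM2r (mulr_ge0 (ltW g0) v0) Lg.
rewrite expr2; lra.
Qed.

(** [Q] stands for (1 - gamma mu)^k. The exponent grows by at most t <= 1 / 2, where the exponential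
    is below its quadratic bound. The linear term is expressed with the unclipped noise, so that it
    can vanish in expectation; [clip_bias] pays for this exchange with a quadratic term. *)
Lemma exp_gap_step (f : 'rV[R]_n -> R) (mu L : R) (xs : 'rV[R]_n)
  (ell Q r0 : R) (x g : 'rV[R]_n) :
  let gamma := (81 * L * ell)^-1 in
  let q := 1 - gamma * mu in
  let lambda := 4 * Num.sqrt (L * Q * r0) in
  0 < mu -> 0 < L -> mu <= L -> strongly_convex mu f -> smooth L f ->
  (forall y, f xs <= f y) -> 2 <= ell -> 0 < Q -> 0 < r0 ->
  f x - f xs <= 2 * Q * r0 ->
  expR (2 * ell * ((f (x - gamma *: clip g lambda) - f xs) / (Q * q * r0))) <=
  expR (2 * ell * ((f x - f xs) / (Q * r0))) *
  (1 - 2 * ell * gamma / (Q * q * r0) * dotv (grad f x) (g - grad f x)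
   + 3 / lambda ^+ 2 * norm2 (g - grad f x) ^+ 2).
Proof.
move=> gamma q lambda mu0 L0 muL sc sm mn ell2 Q0 r00 gap.
have ell0 : 0 < ell by lra.
have D0 : 0 < 81 * L * ell by rewrite !mulr_gt0.
have g0 : 0 < gamma by rewrite invr_gt0.
have Lg : L * gamma * (81 * ell) = 1 by rewrite /gamma; field; rewrite ?gt_eqF//.
have Lg' : L * gamma <= 1 / 162.
  have : L * gamma * 162 <= L * gamma * (81 * ell).
    by apply: ler_wpM2l; [exact: mulr_ge0 (ltW L0) (ltW g0)|lra].
  by rewrite Lg; lra.
have gm : gamma * mu <= 1 / 162.
  by apply: le_trans Lg'; rewrite mulrC ler_wpM2r// ltW.
have gm0 : 0 < gamma * mu by rewrite mulr_gt0.
have q0 : 161 / 162 <= q by rewrite /q; lra.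
have qp : 0 < q by lra.
have W0 : 0 < L * Q * r0 by rewrite !mulr_gt0.
have l0 : 0 < lambda by rewrite mulr_gt0// sqrtr_gt0.
have l2 : lambda ^+ 2 = 16 * (L * Q * r0).
  by rewrite /lambda exprMn sqr_sqrtr ?ltW// -natrX.
have vl : norm2 (grad f x) <= lambda / 2.
  rewrite -(@ler_pXn2r _ 2) ?nnegrE ?norm2_ge0//; last lra.
  rewrite expr_div_n l2; apply: le_trans (sqr_grad_le x L0 sm mn) _.
  have := ler_wpM2l (ltW L0) gap; lra.
set v := grad f x in vl *; set u := clip g lambda.
set th := u - v; set z := norm2 (g - v); set ze := norm2 th.
set B := 2 * ell * gamma / (Q * q * r0).
have B0 : 0 <= B by rewrite divr_ge0 ?mulr_ge0//; lra.
(* The constant 81 of the stepsize enters here: the left side equals 32 / (81 q), with q at least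
   161 / 162. *)
have Bl : B * lambda ^+ 2 <= 2 / 5.
  have -> : B * lambda ^+ 2 = 32 / 81 * (L * gamma * (81 * ell)) / q.
    by rewrite l2 /B; field; rewrite ?gt_eqF//.
  by rewrite Lg ler_pdivrMr; lra.
pose t := B * (L * gamma * ze ^+ 2 - dotv v th).
have stp : 2 * ell * ((f (x - gamma *: u) - f xs) / (Q * q * r0)) <=
    2 * ell * ((f x - f xs) / (Q * r0)) + t.
  have Lg2 : L * gamma <= 1 / 2 by lra.
  have := perturbed_gradient_step xs x u mu0 L0 sc sm g0 Lg2; rewrite -/q -/v -/th -/ze => h.
  have h2 : 0 <= 2 * ell / (Q * q * r0) by rewrite divr_ge0 ?mulr_ge0//; lra.
  have := ler_wpM2l h2 h.
  rewrite [X in X <= _ -> _](_ : _ =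
    2 * ell * ((f (x - gamma *: u) - f xs) / (Q * q * r0))); last by field; rewrite ?gt_eqF//.
  move/le_trans; apply; rewrite le_eqVlt; apply/orP; left; apply/eqP.
  by rewrite /t /B; field; rewrite ?gt_eqF//.
apply: le_trans (_ : expR (2 * ell * ((f x - f xs) / (Q * r0)) + t) <= _).
  by rewrite ler_expR.
rewrite expRD ler_wpM2l ?expR_ge0//.
have ze0 : 0 <= ze by exact: norm2_ge0.
have z0 : 0 <= z by exact: norm2_ge0.
have zez : ze <= z by exact: clip_near.
have zel : ze <= 3 / 2 * lambda.
  apply: le_trans (norm2B_le _ _) _.
  have := norm2_clip g l0; rewrite -/u; lra.
have vth : `|dotv v th| <= lambda / 2 * ze.
  by apply: le_trans (norm_dotv_le _ _) _; rewrite ler_wpM2r.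
have vz : - dotv v th <= - dotv v (g - v) + z ^+ 2 / 4.
  have := clip_bias g l0 vl; rewrite -/u -/z.
  have -> : dotv v (g - u) = dotv v (g - v) - dotv v th.
    by rewrite /th !dotvBr; lra.
  lra.
(* The inner product contributes lambda / 2 and the square lambda / 108, together below 5 / 6
   lambda. Multiplying by B lambda^2 <= 2 / 5 gives 1 / 3, and ze <= 3 / 2 lambda then yields |t| <=
   1 / 2. *)
have absB : B * `|L * gamma * ze ^+ 2 - dotv v th| <= 1 / 3 * (ze / lambda).
  have h1 : `|L * gamma * ze ^+ 2 - dotv v th| <= (5 / 6 * lambda) * ze.
    move: vth; rewrite !ler_norml => /andP[a b].
    have : 0 <= L * gamma * ze ^+ 2 <= lambda / 108 * ze.
      apply/andP; split; first by rewrite !mulr_ge0 ?sqr_ge0// ltW.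
      apply: le_trans (ler_wpM2r (sqr_ge0 _) Lg') _.
      by rewrite expr2; nra.
    nra.
  apply: le_trans (ler_wpM2l B0 h1) _.
  rewrite [X in X <= _](_ : _ = B * lambda ^+ 2 * (5 / 6) * (ze / lambda)); last first.
    by field; rewrite ?gt_eqF//.
  by rewrite ler_wpM2r ?divr_ge0 ?(ltW l0)//; lra.
have tabs : `|t| <= 1 / 3 * (ze / lambda).
  by rewrite /t normrM (ger0_norm B0).
have zl : ze / lambda <= 3 / 2 by rewrite ler_pdivrMr.
have t2 : t <= 1 / 2 by apply: le_trans (ler_norm _) _; lra.
apply: le_trans (expR_le_quadratic t2) _.
have tsq : t ^+ 2 <= z ^+ 2 / lambda ^+ 2.
  rewrite -expr_div_n -real_normK ?num_real// ler_pXn2r ?nnegrE ?divr_ge0 ?(ltW l0)//.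
  apply: le_trans tabs _.
  have : ze / lambda <= z / lambda by rewrite ler_wpM2r// invr_ge0 ltW.
  have : 0 <= ze / lambda by rewrite divr_ge0// ltW.
  lra.
(* The quadratic terms 1 / 162 z^2 and z^2 / 4 are below z^2 / 2. Together with the 2 t^2 of the
   expansion this makes the factor 3 of the statement. *)
have tl : t <= - (B * dotv v (g - v)) + z ^+ 2 / lambda ^+ 2.
  have h1 : t <= B * (- dotv v (g - v) + z ^+ 2 / 2).
    rewrite /t ler_wpM2l//.
    have : L * gamma * ze ^+ 2 <= 1 / 162 * z ^+ 2.
      rewrite ler_pM ?sqr_ge0 ?mulr_ge0 ?(ltW g0) ?(ltW L0)//.
      by rewrite ler_pXn2r ?nnegrE.
    have := sqr_ge0 z; lra.
  apply: le_trans h1 _; rewrite mulrDr mulrN lerD2l.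
  rewrite ler_pdivlMr ?exprn_gt0//.
  have := ler_wpM2r (sqr_ge0 z) Bl; have := sqr_ge0 z; lra.
rewrite -[3 / _ * _]mulrAC; move: tsq tl; rewrite -[3 * _ / _]mulrA; lra.
Qed.

End clipped_step.

(** * Independent sub-sigma-algebras and decoupling *)

Section independence.
Context {R : realType} {d : measure_display} {T : measurableType d}.
Variable P : probability T R.
Local Open Scope ereal_scope.

(** The restriction of [P] to [B] and the multiple of [P] by [P B] are finite measures that agree on
    a pi-system, hence on the sigma-algebra it generates. *)
Lemma pi_system_independence (G : set (set T)) (B : set T) :
  G `<=` measurable -> setI_closed G -> G setT -> measurable B ->
  (forall A, G A -> P (A `&` B) = P A * P B) ->
  forall A, <<s G >> A -> P (A `&` B) = P A * P B.
Proof.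
move=> Gm GI GT mB indep A sA.
have r0 : (0 <= fine (P B))%R by exact: fine_ge0.
have scaleE C : mscale (NngNum r0) P C = P C * P B.
  by rewrite -[P B in RHS](fineK (fin_num_measure P B mB)) muleC.
have E := @g_sigma_algebra_measure_unique _ _ _ G Gm (fun=> setT) (fun=> GT)
  _ (mrestr P mB) (mscale (NngNum r0) P) GI _ _ A sA.
rewrite -/(mrestr P mB A) {}E.
- exact: scaleE.
- by rewrite bigcup_const//; exists 0%N.
- move=> C GC; rewrite [RHS]scaleE; exact: indep.
- by move=> _; rewrite /mrestr -ge0_fin_numE// fin_num_measure// setTI.
Qed.

Variables G1 G2 : set (set T).
Hypotheses (G1m : G1 `<=` measurable) (G2m : G2 `<=` measurable).
Hypotheses (G1I : setI_closed G1) (G2I : setI_closed G2).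
Hypotheses (G1T : G1 setT) (G2T : G2 setT).
Hypothesis indep : forall A B, G1 A -> G2 B -> P (A `&` B) = P A * P B.

(** [T1] and [T2] have the points of [T] with coarser sigma-algebras, so the identity from [T] to
    either is measurable. *)
Let T1 : measurableType _ := g_sigma_algebraType G1.
Let T2 : measurableType _ := g_sigma_algebraType G2.

(** The pi-system argument is applied to one factor at a time, the other event being held fixed. *)
Lemma generated_independence A B : <<s G1 >> A -> <<s G2 >> B ->
  P (A `&` B) = P A * P B.
Proof.
move=> sA sB.
have mA : measurable A by exact: (smallest_sub (@sigma_algebra_measurable _ T) G1m).
rewrite setIC muleC; apply: (pi_system_independence G2m) => // {sB}B gB.
rewrite setIC muleC; apply: (pi_system_independence G1m) => //; first exact: G2m.
by move=> C gC; exact: indep.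
Qed.

(* The law of [w |-> (w, w)] for the product of the two sub-sigma-algebras is the
   product law. *)
Lemma decoupling (h : T1 * T2 -> \bar R) :
  measurable_fun setT h -> (forall z, 0 <= h z) ->
  \int[P]_w h (w, w) = \int[P]_v \int[P]_w h (v, w).
Proof.
move=> mh h0.
have m1 : measurable_fun setT ((fun w => w) : T -> T1).
  move=> _ A mA; rewrite setTI.
  exact: (smallest_sub (@sigma_algebra_measurable _ T) G1m).
have m2 : measurable_fun setT ((fun w => w) : T -> T2).
  move=> _ A mA; rewrite setTI.
  exact: (smallest_sub (@sigma_algebra_measurable _ T) G2m).
have m12 : measurable_fun setT ((fun w => (w, w)) : T -> (T1 * T2)%type).
  exact: measurable_fun_pair.
pose X1 : {mfun T >-> T1} := HB.pack ((fun w => w) : T -> T1)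
  (isMeasurableFun.Build _ _ _ _ _ m1).
pose X2 : {mfun T >-> T2} := HB.pack ((fun w => w) : T -> T2)
  (isMeasurableFun.Build _ _ _ _ _ m2).
pose X12 : {mfun T >-> (T1 * T2)%type} :=
  HB.pack ((fun w => (w, w)) : T -> (T1 * T2)%type)
  (isMeasurableFun.Build _ _ _ _ _ m12).
transitivity (\int[distribution P X12]_z h z).
  by rewrite (@ge0_integral_distribution _ _ _ _ _ P X12 h mh h0).
transitivity (\int[distribution P X1 \x distribution P X2]_z h z).
  apply: eq_measure_integral => A mA _; apply/esym.
  apply: product_measure_unique => // B C mB mC.
  exact: generated_independence.
rewrite fubini_tonelli1// ge0_integral_distribution//.
- apply: eq_integral => v _ /=; rewrite /fubini_F ge0_integral_distribution//.
  exact: measurableT_comp.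
- exact: measurable_fun_fubini_tonelli_F.
- by move=> v; exact: integral_ge0.
Qed.

End independence.

(** * Sigma-algebras generated by families of samples *)

Section cylinders.
Context {I : eqType} {d dO : measure_display}.
Context {Xi : measurableType d} {Omega : measurableType dO}.
Variable xi : I -> Omega -> Xi.
Implicit Types S : set I.

(** Finite-dimensional events are the ones on which mutual independence is stated; they form a
    pi-system generating the sigma-algebra of the samples indexed by [S]. *)
Definition cylinder S : set (set Omega) :=
  [set E | exists (J : seq I) (A : I -> set Xi),
    [/\ uniq J, forall i, i \in J -> S i, forall i, measurable (A i) &
        E = [set w | forall i, i \in J -> A i (xi i w)]]].

Lemma cylinder_setT S : cylinder S setT.
Proof.
exists [::], (fun=> setT); split => //.
by apply/seteqP; split.
Qed.

Lemma cylinder_setI S : setI_closed (cylinder S).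
Proof.
move=> _ _ [J1 [A1 [_ S1 m1 ->]]] [J2 [A2 [_ S2 m2 ->]]].
(* The two lists may share indices, hence [undup]; an index absent from one of them is constrained
   there by [setT]. *)
exists (undup (J1 ++ J2)), (fun i =>
  (if i \in J1 then A1 i else setT) `&` (if i \in J2 then A2 i else setT)).
split; first exact: undup_uniq.
- by move=> i; rewrite mem_undup mem_cat => /orP[/S1|/S2].
- by move=> i; apply: measurableI; case: ifP.
apply/seteqP; split => w /=.
  move=> [h1 h2] i _; split; case: ifP => // iJ; [exact: h1|exact: h2].
move=> h; split => i iJ; have := h i;
  by rewrite mem_undup mem_cat iJ ?orbT => /(_ isT)[].
Qed.

Lemma cylinder_measurable S :
  (forall i, S i -> measurable_fun setT (xi i)) ->
  cylinder S `<=` measurable.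
Proof.
move=> mxi _ [J [A [_ SJ mA ->]]].
elim: J SJ => [_|i J IH SJ].
  rewrite [X in measurable X](_ : _ = setT) //.
  by apply/seteqP; split.
rewrite [X in measurable X](_ : _ = xi i @^-1` A i `&`
  [set w | forall i, i \in J -> A i (xi i w)]).
  apply: measurableI; last by apply: IH => j jJ; apply: SJ; rewrite inE jJ orbT.
  rewrite -[X in measurable X]setTI; apply: mxi => //.
  by apply: SJ; rewrite mem_head.
apply/seteqP; split => w /=.
  move=> h; split; first by apply: h; rewrite mem_head.
  by move=> j jJ; apply: h; rewrite inE jJ orbT.
by move=> [h1 h2] j; rewrite inE => /orP[/eqP ->//|]; exact: h2.
Qed.

Lemma measurable_coordinate S i : S i ->
  measurable_fun [set: g_sigma_algebraType (cylinder S)] (xi i).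
Proof.
move=> Si _ A mA; rewrite setTI; apply: sub_sigma_algebra.
exists [:: i], (fun=> A); split => //.
  by move=> j; rewrite inE => /eqP ->.
apply/seteqP; split => w /=.
  by move=> Aw j; rewrite inE => /eqP ->.
by apply; rewrite mem_head.
Qed.

(** As [S1] and [S2] are disjoint, the concatenated index list has no repetition, and mutual
    independence over it splits into the two products. *)
Lemma cylinder_independence {R : realType} (P : probability Omega R) S S1 S2 :
  mutually_independent P S xi -> S1 `<=` S -> S2 `<=` S -> S1 `&` S2 = set0 ->
  forall A B, cylinder S1 A -> cylinder S2 B -> P (A `&` B) = (P A * P B)%E.
Proof.
move=> ind S1S S2S S12 _ _ [J1 [A1 [u1 s1 m1 ->]]] [J2 [A2 [u2 s2 m2 ->]]].
rewrite (ind J1)//; last by move=> i /s1/S1S.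
rewrite (ind J2)//; last by move=> i /s2/S2S.
have dis i : i \in J2 -> i \notin J1.
  move=> /s2 h2; apply/negP => /s1 h1.
  by have : set0 i by rewrite -S12; split.
pose A i := if i \in J1 then A1 i else A2 i.
have -> : [set w | forall i, i \in J1 -> A1 i (xi i w)] `&`
    [set w | forall i, i \in J2 -> A2 i (xi i w)] =
    [set w | forall i, i \in J1 ++ J2 -> A i (xi i w)].
  apply/seteqP; split => w /=.
    move=> [h1 h2] i; rewrite mem_cat /A; case: ifPn => [iJ _|_ /=]; first exact: h1.
    exact: h2.
  move=> h; split => i iJ; have := h i; rewrite mem_cat iJ ?orbT /A.
    by rewrite iJ => /(_ isT).
  by rewrite (negbTE (dis _ iJ)) => /(_ isT).
rewrite ind.
- rewrite big_cat/=; congr (_ * _)%E; rewrite !big_seq; apply: eq_bigr => i iJ.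
    by rewrite /A iJ.
  by rewrite /A (negbTE (dis _ iJ)).
- rewrite cat_uniq u1 u2 andbT/=; apply/hasPn => i; exact: dis.
- by move=> i; rewrite mem_cat => /orP[/s1/S1S|/s2/S2S].
- by move=> i; rewrite /A; case: ifP.
Qed.

Lemma independent_decoupling {R : realType} (P : probability Omega R) S S1 S2
    (h : g_sigma_algebraType (cylinder S1) * g_sigma_algebraType (cylinder S2)
         -> \bar R) :
  (forall i, S i -> measurable_fun setT (xi i)) ->
  mutually_independent P S xi -> S1 `<=` S -> S2 `<=` S -> S1 `&` S2 = set0 ->
  measurable_fun setT h -> (forall z, 0 <= h z)%E ->
  (\int[P]_w h (w, w) = \int[P]_v \int[P]_w h (v, w))%E.
Proof.
move=> mxi ind S1S S2S S12 mh h0.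
apply: (decoupling (G1 := cylinder S1) (G2 := cylinder S2)) => //.
- by apply: cylinder_measurable => i /S1S; exact: mxi.
- by apply: cylinder_measurable => i /S2S; exact: mxi.
- exact: cylinder_setI.
- exact: cylinder_setI.
- exact: cylinder_setT.
- exact: cylinder_setT.
- exact: cylinder_independence ind _ _ _.
Qed.

Lemma g_sigma_cylinder_measurable_fun S d' (Y : measurableType d')
    (X : Omega -> Y) :
  (forall i, S i -> measurable_fun setT (xi i)) ->
  measurable_fun [set: g_sigma_algebraType (cylinder S)] X ->
  measurable_fun [set: Omega] X.
Proof.
move=> mxi mX _ A mA.
apply: (smallest_sub (@sigma_algebra_measurable _ Omega)
  (cylinder_measurable mxi)).
exact: mX.
Qed.


Lemma g_sigma_cylinder_integral_measurable {R : realType}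
    (P : probability Omega R) S S1 S2
    (h : g_sigma_algebraType (cylinder S1) * g_sigma_algebraType (cylinder S2)
         -> \bar R) :
  (forall i, S i -> measurable_fun setT (xi i)) -> S2 `<=` S ->
  measurable_fun setT h -> (forall z, 0 <= h z)%E ->
  measurable_fun [set: g_sigma_algebraType (cylinder S1)]
    (fun v => \int[P]_w h (v, w))%E.
Proof.
move=> mxi S2S mh h0.
have m2 : measurable_fun setT
    ((fun w => w) : Omega -> g_sigma_algebraType (cylinder S2)).
  apply: g_sigma_cylinder_measurable_fun (fun i h => mxi _ (S2S i h)) _.
  exact: measurable_id.
(* The law of this identity map is [P] seen on the smaller sigma-algebra, so Tonelli's measurability
   statement applies to the product. *)
pose X2 : {mfun Omega >-> g_sigma_algebraType (cylinder S2)} :=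
  HB.pack ((fun w => w) : Omega -> g_sigma_algebraType (cylinder S2))
  (isMeasurableFun.Build _ _ _ _ _ m2).
have := @measurable_fun_fubini_tonelli_F _ _ _ _ _ (distribution P X2) h mh h0.
apply: eq_measurable_fun => v _; rewrite /fubini_F ge0_integral_distribution//.
exact: measurableT_comp.
Qed.

End cylinders.

(** * Measurability of random vectors *)

Section measurable_vectors.
Context {R : realType} {n : nat}.

Definition measurable_rV d (T : measurableType d) (X : T -> 'rV[R]_n) :=
  forall j, measurable_fun [set: T] (fun w => X w 0 j).

Lemma row_mktuple (u : 'rV[R]_n) : \row_i tnth [tuple u 0 i | i < n] i = u.
Proof. by apply/rowP => i; rewrite mxE tnth_mktuple. Qed.

(** An open set is the countable union of the rational boxes that it contains. *)
Lemma open_rV_measurable (U : set 'rV[R]_n) : open U ->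
  measurable [set t : n.-tuple R | U (\row_i tnth t i)].
Proof.
move=> oU.
pose box (p : 'rV[rat]_n * nat) : set (n.-tuple R) :=
  [set t | forall i, `|tnth t i - ratr (p.1 0 i)| < p.2.+1%:R^-1].
(* Boxes not contained in [U] are replaced by the empty set, so that the union runs over a countable
   type. *)
pose F p := if pselect (box p `<=` [set t | U (\row_i tnth t i)])
  then box p else set0.
have mF p : measurable (F p).
  rewrite /F; case: (pselect _) => [a|a] /=; last exact: measurable0.
  rewrite (_ : box p = \bigcap_(i in [set: 'I_n]) ((fun t : n.-tuple R => tnth t i)
      @^-1` [set y | `|y - ratr (p.1 0 i)| < p.2.+1%:R^-1])); last first.
    by apply/seteqP; split => t h i; [move=> ?; exact: h|exact: (h i I)].
  apply: fin_bigcap_measurable => // i _.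
  rewrite -[X in measurable X]setTI; apply: measurable_tnth => //.
  rewrite -[X in measurable X]setTI.
  have mf : measurable_fun [set: R] (fun y : R => `|y - ratr (p.1 0 i)| < p.2.+1%:R^-1).
    apply: measurable_fun_ltr => //; apply: measurableT_comp => //.
    exact: measurable_funB.
  exact: (mf measurableT [set true]).
rewrite (_ : [set t | _] = \bigcup_p F p).
  by apply: countable_bigcupT_measurable => //; exact: countableP.
apply/seteqP; split => [t Ut|t [p _]]; last first.
  by rewrite /F; case: (pselect _) => [sub|a []]; exact: sub.
have /nbhs_ballP[e /= e0 eU] : nbhs (\row_i tnth t i) U by exact: open_nbhs_nbhs.
(* The box has radius 1 / (k + 1) and its centre is equally close to [t], so its points lie within 2
   / (k + 1) of [t]. *)
have [k ke] : exists k : nat, 2 * k.+1%:R^-1 < e.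
  exists (Num.truncn (2 / e)).
  rewrite ltr_pdivrMr// mulrC -ltr_pdivrMr//.
  by rewrite truncnS_gt// divr_ge0// ltW.
have rat_near (y : R) : exists r : rat, `|y - ratr r| < k.+1%:R^-1.
  have h : y - k.+1%:R^-1 < y + k.+1%:R^-1.
    by rewrite ltrD2l; apply: lt_trans (_ : 0 < _); rewrite ?oppr_lt0 invr_gt0.
  have [r] := rat_in_itvoo h; rewrite in_itv/= => /andP[h1 h2].
  by exists r; rewrite distrC ltr_distl h1 h2.
pose r i := projT1 (cid (rat_near (tnth t i))).
have rP i : `|tnth t i - ratr (r i)| < k.+1%:R^-1 by rewrite /r; case: cid.
exists (\row_i r i, k) => //; rewrite /F; case: (pselect _) => [a|].
  by move=> i /=; rewrite mxE.
case=> s /= sb; apply: eU; split => // i j; rewrite !ord1 !mxE.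
have := sb j; rewrite mxE => h1.
rewrite /ball/=; apply: lt_trans ke; rewrite mulr_natl mulr2n.
rewrite -(subrKA (ratr (r j))) (le_lt_trans (ler_normD _ _))// ltrD//.
by rewrite distrC.
Qed.

Section operations.
Context {d : measure_display} {T : measurableType d}.
Implicit Types X Y : T -> 'rV[R]_n.

Lemma measurable_mktuple X : measurable_rV X ->
  measurable_fun [set: T] (fun w => [tuple X w 0 i | i < n]).
Proof.
move=> mX; apply/measurable_fun_tnthP => i.
rewrite (_ : _ \o _ = fun w => X w 0 i)//.
by apply/funext => w /=; rewrite tnth_mktuple.
Qed.

Lemma measurable_continuous_rV (f : 'rV[R]_n -> R) X : continuous f ->
  measurable_rV X -> measurable_fun [set: T] (fun w => f (X w)).
Proof.
move=> cf mX.
have mf : measurable_fun [set: n.-tuple R] (fun t => f (\row_i tnth t i)).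
  apply: (measurability _ (RGenOInfty.measurableE R)) => _ [_ [a ->] <-].
  rewrite setTI; apply: (@open_rV_measurable (f @^-1` `]a, +oo[)).
  by apply: open_comp => // x _; exact: cf.
rewrite (_ : (fun w => _) = (fun t => f (\row_i tnth t i)) \o
    (fun w => [tuple X w 0 i | i < n])).
  by apply: measurableT_comp => //; exact: measurable_mktuple.
by apply/funext => w /=; rewrite row_mktuple.
Qed.

Lemma measurable_rV_cst (x : 'rV[R]_n) : measurable_rV (fun _ : T => x).
Proof. by move=> j; exact: measurable_cst. Qed.

Lemma measurable_rVD X Y : measurable_rV X -> measurable_rV Y ->
  measurable_rV (fun w => X w + Y w).
Proof.
move=> mX mY j; rewrite (_ : (fun w => _) = fun w => X w 0 j + Y w 0 j).
  exact: measurable_funD.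
by apply/funext => w; rewrite mxE.
Qed.

Lemma measurable_rVZ (a : T -> R) X : measurable_fun setT a ->
  measurable_rV X -> measurable_rV (fun w => a w *: X w).
Proof.
move=> ma mX j; rewrite (_ : (fun w => _) = fun w => a w * X w 0 j).
  exact: measurable_funM.
by apply/funext => w; rewrite mxE.
Qed.

Lemma measurable_rVB X Y : measurable_rV X -> measurable_rV Y ->
  measurable_rV (fun w => X w - Y w).
Proof.
move=> mX mY j; rewrite (_ : (fun w => _) = fun w => X w 0 j - Y w 0 j).
  exact: measurable_funB.
by apply/funext => w; rewrite !mxE.
Qed.

Lemma measurable_rV_sum (I : Type) (s : seq I) (X : I -> T -> 'rV[R]_n) :
  (forall i, measurable_rV (X i)) ->
  measurable_rV (fun w => \sum_(i <- s) X i w).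
Proof.
move=> mX j; rewrite (_ : (fun w => _) = fun w => \sum_(i <- s) X i w 0 j).
  by apply: measurable_sum => i; exact: mX.
by apply/funext => w; rewrite summxE.
Qed.

Lemma measurable_dotv X Y : measurable_rV X -> measurable_rV Y ->
  measurable_fun [set: T] (fun w => dotv (X w) (Y w)).
Proof. by move=> mX mY; apply: measurable_sum => i; exact: measurable_funM. Qed.

Lemma measurable_norm2 X : measurable_rV X ->
  measurable_fun [set: T] (fun w => norm2 (X w)).
Proof.
move=> mX; apply: (@measurableT_comp _ _ _ _ _ _ (@Num.sqrt R)).
  by apply: continuous_measurable_fun; exact: sqrt_continuous.
exact: measurable_dotv.
Qed.

Lemma measurable_clip X lambda : 0 < lambda -> measurable_rV X ->
  measurable_rV (fun w => clip (X w) lambda).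
Proof.
move=> l0 mX; have mN := measurable_norm2 mX.
(* The inverse of the norm is written as exp (- ln), a composition of measurable functions; this is
   legitimate where the norm exceeds lambda > 0. *)
rewrite (_ : (fun w => _) = fun w => (if norm2 (X w) <= lambda then 1
    else lambda * expR (- ln (norm2 (X w)))) *: X w).
  apply: measurable_rVZ => //; apply: measurable_fun_ifT => //.
    exact: measurable_fun_ler.
  apply: measurable_funM => //; apply: measurableT_comp => //.
  apply: measurable_funN; apply: (@measurableT_comp _ _ _ _ _ _ (@ln R)) => //.
apply/funext => w; case: ifPn => [h|]; first by rewrite clip_id// scale1r.
rewrite -ltNge => h; have N0 := lt_trans l0 h.
by rewrite clipE// expRN lnK.
Qed.

End operations.
End measurable_vectors.

(** * Integrability, centred variables and change of law *)

Section moments.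
Context {R : realType} {d : measure_display} {T : measurableType d}.
Variable P : probability T R.
Local Open Scope ereal_scope.

(** The integral is the difference of two nonnegative terms, from the positive and negative parts,
    and is finite only if both are. *)
Lemma integrable_of_fin_num (g : T -> R) : measurable_fun setT g ->
  \int[P]_w (g w)%:E \is a fin_num -> P.-integrable setT (EFin \o g).
Proof.
move=> mg fin; have mg' : measurable_fun setT (EFin \o g) by exact/measurable_EFinP.
apply/integrableP; split => //.
have p0 : 0 <= \int[P]_w (EFin \o g)^\+ w by exact: integral_ge0.
have n0 : 0 <= \int[P]_w (EFin \o g)^\- w by exact: integral_ge0.
rewrite -[fun x => _]/(abse \o (EFin \o g)) fune_abse.
rewrite ge0_integralD//; last 2 first.
- exact: measurable_funepos.
- exact: measurable_funeneg.
move: fin p0 n0; rewrite [X in X \is a fin_num]integralE.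
by case: (integral _ _ _^\+) => [a| |]; case: (integral _ _ _^\-) => [b| |]//=; rewrite ?ltry.
Qed.

(** This is the shape of both expectation bounds below: a constant, a centred linear term and a
    quadratic remainder. *)
Lemma integral_affine_le (a b : R) (l z : T -> R) :
  P.-integrable setT (EFin \o l) -> \int[P]_w (l w)%:E = 0 ->
  measurable_fun setT z -> (forall w, 0 <= z w)%R ->
  \int[P]_w (z w)%:E <= b%:E ->
  \int[P]_w (a + l w + z w)%:E <= (a + b)%:E.
Proof.
move=> il l0 mz z0 zb.
have iz : P.-integrable setT (EFin \o z).
  apply: integrable_of_fin_num => //; rewrite ge0_fin_numE.
    exact: le_lt_trans zb (ltry _).
  by apply: integral_ge0 => w _; rewrite lee_fin.
have ia : P.-integrable setT (EFin \o cst a) by exact: finite_measure_integrable_cst.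
under eq_integral do rewrite !EFinD.
rewrite integralD//; last exact: integrableD.
rewrite integralD// l0 adde0 integral_cst//.
rewrite [X in _ * X + _](_ : _ = 1); last exact: probability_setT.
by rewrite mule1 EFinD leeD2l.
Qed.

End moments.

Section centred.
Context {R : realType} {d : measure_display} {T : measurableType d}.
Variable P : probability T R.
Local Open Scope ereal_scope.

Definition centred (l : T -> R) :=
  P.-integrable setT (EFin \o l) /\ \int[P]_w (l w)%:E = 0.

Lemma centred_measurable l : centred l -> measurable_fun setT l.
Proof. by move=> [/measurable_int /measurable_EFinP]. Qed.

Lemma centredZ (a : R) l : centred l -> centred (fun w => a * l w)%R.
Proof.
move=> [il l0]; split.
  rewrite (_ : EFin \o _ = fun w => a%:E * (EFin \o l) w); first exact: integrableZl.
  by apply/funext => w /=; rewrite EFinM.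
under eq_integral do rewrite EFinM.
by rewrite integralZl// l0 mule0.
Qed.

Lemma centred_sum (I : Type) (s : seq I) (l : I -> T -> R) :
  (forall i, centred (l i)) -> centred (fun w => \sum_(i <- s) l i w)%R.
Proof.
move=> cl; have E w : (\sum_(i <- s) l i w)%:E = \sum_(i <- s) (EFin \o l i) w.
  by rewrite sumEFin.
split.
  rewrite (_ : EFin \o _ = fun w => \sum_(i <- s) (EFin \o l i) w).
    by apply: integrable_sum => // i _; exact: (cl i).1.
  by apply/funext => w; exact: E.
under eq_integral do rewrite E.
rewrite integral_sum//; last by move=> i; exact: (cl i).1.
by rewrite big1// => i _; exact: (cl i).2.
Qed.

Lemma centredB_mean (g : T -> R) (a : R) : measurable_fun setT g ->
  \int[P]_w (g w)%:E = a%:E -> centred (fun w => g w - a)%R.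
Proof.
move=> mg ga; have ig : P.-integrable setT (EFin \o g).
  by apply: integrable_of_fin_num => //; rewrite ga.
have ia : P.-integrable setT (EFin \o cst a) by exact: finite_measure_integrable_cst.
split.
  rewrite (_ : EFin \o _ = (EFin \o g) \- (EFin \o cst a)); first exact: integrableB.
  by apply/funext => w /=; rewrite EFinB.
under eq_integral do rewrite EFinB.
rewrite (integralB_EFin _ ig ia)//= ga integral_cst//.
rewrite [X in _ * X](_ : _ = 1); last exact: probability_setT.
by rewrite mule1 subee.
Qed.

End centred.

Section change_of_law.
Context {R : realType} {d dO : measure_display}.
Context {Xi : measurableType d} {Omega : measurableType dO}.
Variables (P : probability Omega R) (D : probability Xi R) (X : Omega -> Xi).
Hypothesis mX : measurable_fun setT X.
Hypothesis lawX : forall A, measurable A -> P (X @^-1` A) = D A.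
Local Open Scope ereal_scope.

Lemma ge0_integral_law (g : Xi -> \bar R) : measurable_fun setT g ->
  (forall y, 0 <= g y) -> \int[P]_w g (X w) = \int[D]_y g y.
Proof.
move=> mg g0.
pose X' : {mfun Omega >-> Xi} := HB.pack X (isMeasurableFun.Build _ _ _ _ _ mX).
transitivity (\int[distribution P X']_y g y).
  by rewrite (ge0_integral_distribution X').
by apply: eq_measure_integral => A mA _; exact: lawX.
Qed.

(** Positive and negative parts are transported separately; integrability is then derived from the
    finite value by [centredB_mean]. *)
Lemma integral_law (g : Xi -> R) : measurable_fun setT g ->
  \int[P]_w (g (X w))%:E = \int[D]_y (g y)%:E.
Proof.
move=> mg; have mg' : measurable_fun setT (EFin \o g) by exact/measurable_EFinP.
have p := ge0_integral_law (measurable_funepos mg') (fun y => funepos_ge0 _ y).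
have q := ge0_integral_law (measurable_funeneg mg') (fun y => funeneg_ge0 _ y).
rewrite [LHS]integralE [RHS]integralE -p -q.
by congr (_ - _); apply: eq_integral => w _; rewrite ?funeposE ?funenegE.
Qed.

End change_of_law.

(** * Mean and variance of the minibatch gradient *)

Section stochastic_gradients.
Context {R : realType} {n : nat} {d : measure_display} {Xi : measurableType d}.
Variables (D : probability Xi R) (sigma : R).
Variables (f : 'rV[R]_n -> R) (G : 'rV[R]_n -> Xi -> 'rV[R]_n).
Hypothesis SG : stochastic_gradient D sigma f G.

Lemma measurable_stochastic_gradient d' (T : measurableType d')
    (X : T -> 'rV[R]_n) (s : T -> Xi) :
  measurable_rV X -> measurable_fun setT s -> measurable_rV (fun w => G (X w) (s w)).
Proof.
move=> mX ms j; case: SG => mG _ _.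
rewrite (_ : (fun w => _) = (fun z : n.-tuple R * Xi =>
  G (\row_i tnth z.1 i) z.2 0 j) \o (fun w => ([tuple X w 0 i | i < n], s w))).
  apply: measurableT_comp; first exact: mG.
  by apply: measurable_fun_pair => //; exact: measurable_mktuple.
by apply/funext => w /=; rewrite row_mktuple.
Qed.

Section sampled.
Context {dO : measure_display} {Omega : measurableType dO}.
Variables (P : probability Omega R) (N : nat) (m : nat -> nat).
Variable xi : nat * nat -> Omega -> Xi.
Hypothesis iid : iid_samples P D N m xi.

Let S := [set ki : nat * nat | (ki.1 < N)%N /\ (ki.2 < m ki.1)%N].

Lemma centred_noise (x v : 'rV[R]_n) ki : S ki ->
  centred P (fun w => dotv v (G x (xi ki w) - grad f x)).
Proof.
move=> Ski; case: iid => mxi law _; case: SG => mG EG _.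
rewrite (_ : (fun w => _) = fun w => \sum_(j < n)
    v 0 j * (G x (xi ki w) 0 j - grad f x 0 j)); last first.
  by apply/funext => w; apply: eq_bigr => j _; rewrite !mxE.
apply: centred_sum => j; apply: centredZ; apply: centredB_mean.
  by apply: measurable_stochastic_gradient; [exact: measurable_rV_cst|exact: mxi].
rewrite (integral_law (mxi _ Ski) (law _ Ski) (g := fun y => G x y 0 j)).
  by have := EG x j; rewrite unlock.
by apply: (@measurable_stochastic_gradient _ Xi (fun=> x) id);
  [exact: measurable_rV_cst|exact: measurable_id].
Qed.

Lemma noise_second_moment (x : 'rV[R]_n) ki : S ki ->
  (\int[P]_w (norm2 (G x (xi ki w) - grad f x) ^+ 2)%:E <= (sigma ^+ 2)%:E)%E.
Proof.
move=> Ski; case: iid => mxi law _; case: SG => mG _ VG.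
have := VG x; rewrite unlock; apply: le_trans.
rewrite (ge0_integral_law (mxi _ Ski) (law _ Ski)
  (g := fun y => (norm2 (G x y - grad f x) ^+ 2)%:E))//; last first.
  by move=> y; rewrite lee_fin sqr_ge0.
apply/measurable_EFinP; apply: measurable_funX; apply: measurable_norm2.
apply: measurable_rVB; last exact: measurable_rV_cst.
by apply: (@measurable_stochastic_gradient _ Xi (fun=> x) id);
  [exact: measurable_rV_cst|exact: measurable_id].
Qed.

Let noise_sum (x : 'rV[R]_n) k p w :=
  \sum_(i < p) (G x (xi (k, val i) w) - grad f x).

(** Induction on the number of samples. The last sample is independent of the earlier ones; once
    decoupled, its inner product with the fixed partial sum is centred, so that only its own
    variance is added. *)
Lemma noise_sum_second_moment x k p : (k < N)%N -> (p <= m k)%N ->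
  (\int[P]_w (norm2 (noise_sum x k p w) ^+ 2)%:E <= (p%:R * sigma ^+ 2)%:E)%E.
Proof.
move=> kN; case: (iid) => mxi law ind; elim: p => [_|p IH pm].
  rewrite mul0r integral0_eq// => w _; rewrite /noise_sum big_ord0.
  by rewrite sqr_norm2 dot0v.
have Skp : S (k, p) by [].
pose S1 : set (nat * nat) := [set ki | ki.1 = k /\ (ki.2 < p)%N].
pose S2 : set (nat * nat) := [set (k, p)].
have S1S : S1 `<=` S by move=> [a b] [/= -> bp]; split => //=; exact: ltn_trans pm.
have S2S : S2 `<=` S by move=> _ ->.
have S12 : S1 `&` S2 = set0.
  by apply/seteqP; split => // -[a b] [[/= _ h] [_ e]]; rewrite e ltnn in h.
pose T1 : measurableType _ := g_sigma_algebraType (cylinder xi S1).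
pose T2 : measurableType _ := g_sigma_algebraType (cylinder xi S2).
pose Y w := G x (xi (k, p) w) - grad f x.
(* The space is left arbitrary because measurability is needed both on [T1] and on [Omega]. *)
have msum d' (T : measurableType d') (xi' : nat * nat -> T -> Xi) :
    (forall i, (i < p)%N -> measurable_fun setT (xi' (k, i))) ->
    measurable_rV (fun w => \sum_(i < p) (G x (xi' (k, val i) w) - grad f x)).
  move=> mxi'; apply: measurable_rV_sum => i; apply: measurable_rVB.
    by apply: measurable_stochastic_gradient; [exact: measurable_rV_cst|exact: (mxi' _ (ltn_ord i))].
  exact: measurable_rV_cst.
have mS1 : @measurable_rV _ _ _ T1 (noise_sum x k p).
  by apply: (msum _ T1 xi) => i ip; apply: (@measurable_coordinate _ _ _ _ _ xi S1 (k, i)); split.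
have mS : @measurable_rV _ _ _ Omega (noise_sum x k p).
  by apply: msum => i ip; apply: mxi; apply: S1S.
have mY2 : @measurable_rV _ _ _ T2 Y.
  apply: measurable_rVB; last exact: measurable_rV_cst.
  apply: measurable_stochastic_gradient; first exact: measurable_rV_cst.
  exact: measurable_coordinate.
have mY : @measurable_rV _ _ _ Omega Y.
  apply: measurable_rVB; last exact: measurable_rV_cst.
  apply: measurable_stochastic_gradient; first exact: measurable_rV_cst.
  exact: mxi.
pose h (z : T1 * T2) := (norm2 (noise_sum x k p z.1 + Y z.2) ^+ 2)%:E.
have mh : measurable_fun setT h.
  apply/measurable_EFinP; apply: measurable_funX; apply: measurable_norm2.
  apply: measurable_rVD => j.
    exact: (measurableT_comp (mS1 j) measurable_fst).
  exact: (measurableT_comp (mY2 j) measurable_snd).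
have -> : (\int[P]_w (norm2 (noise_sum x k p.+1 w) ^+ 2)%:E =
    \int[P]_w h (w, w))%E.
  by apply: eq_integral => w _; rewrite /h /noise_sum big_ord_recr.
rewrite (independent_decoupling mxi ind S1S S2S S12 mh); last first.
  by move=> z; rewrite lee_fin sqr_ge0.
have mN : measurable_fun [set: Omega] (fun v => (norm2 (noise_sum x k p v) ^+ 2)%:E).
  by apply/measurable_EFinP; apply: measurable_funX; exact: measurable_norm2.
apply: (@le_trans _ _ (\int[P]_v ((norm2 (noise_sum x k p v) ^+ 2)%:E +
    (sigma ^+ 2)%:E))%E).
  apply: ge0_le_integral => //.
  - by move=> v _; apply: integral_ge0 => w _; rewrite lee_fin sqr_ge0.
  - apply: (g_sigma_cylinder_measurable_fun (S := S1) (xi := xi)).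
      by move=> i /S1S; exact: mxi.
    apply: (g_sigma_cylinder_integral_measurable P mxi S2S mh).
    by move=> z; rewrite lee_fin sqr_ge0.
  - by apply: emeasurable_funD => //; exact: measurable_cst.
  move=> v _; rewrite -EFinD /h /=.
  under eq_integral do rewrite norm2D_sqr.
  have [ic c0] := centredZ 2 (centred_noise x (noise_sum x k p v) Skp).
  apply: integral_affine_le => //.
  - by apply: measurable_funX; exact: measurable_norm2.
  - by move=> w; exact: sqr_ge0.
  - exact: noise_second_moment.
rewrite ge0_integralD//; do ?by move=> *; rewrite lee_fin sqr_ge0.
rewrite integral_cst// [X in ((sigma ^+ 2)%:E * X)%E](_ : _ = 1%E); last first.
  exact: probability_setT.
rewrite mule1 -natr1 mulrDl mul1r EFinD leeD2r//.
by apply: IH; exact: ltnW.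
Qed.

Lemma minibatch_noise x k w : (0 < m k)%N ->
  minibatch_grad G m xi k x w - grad f x = (m k)%:R^-1 *: noise_sum x k (m k) w.
Proof.
move=> mk; rewrite /minibatch_grad /noise_sum sumrB scalerBr; congr (_ - _).
by rewrite sumr_const card_ord -[grad f x *+ _]scaler_nat scalerA mulVf ?scale1r// pnatr_eq0 -lt0n.
Qed.

Lemma minibatch_variance x k : (k < N)%N -> (0 < m k)%N ->
  (\int[P]_w (norm2 (minibatch_grad G m xi k x w - grad f x) ^+ 2)%:E
    <= (sigma ^+ 2 / (m k)%:R)%:E)%E.
Proof.
move=> kN mk; have mR : 0 < (m k)%:R :> R by rewrite ltr0n.
have mxi : forall ki, S ki -> measurable_fun setT (xi ki) by case: iid.
under eq_integral do rewrite minibatch_noise// norm2Z ?invr_ge0 ?ler0n// exprMn EFinM.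
rewrite ge0_integralZl_EFin//.
- apply: le_trans (lee_wpmul2l _ (noise_sum_second_moment x kN (leqnn _))) _.
    by rewrite lee_fin sqr_ge0.
  by rewrite -EFinM lee_fin le_eqVlt; apply/orP; left; apply/eqP; field; rewrite gt_eqF.
- by move=> w _; rewrite lee_fin sqr_ge0.
- apply/measurable_EFinP; apply: measurable_funX; apply: measurable_norm2.
  apply: measurable_rV_sum => i; apply: measurable_rVB; last exact: measurable_rV_cst.
  apply: measurable_stochastic_gradient; first exact: measurable_rV_cst.
  by apply: mxi; split => /=.
Qed.

Lemma centred_minibatch x v k : (k < N)%N -> (0 < m k)%N ->
  centred P (fun w => dotv v (minibatch_grad G m xi k x w - grad f x)).
Proof.
move=> kN mk.
rewrite (_ : (fun w => _) = fun w => (m k)%:R^-1 *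
    \sum_(i < m k) dotv v (G x (xi (k, val i) w) - grad f x)).
  by apply: centredZ; apply: centred_sum => i; apply: centred_noise; split => /=.
apply/funext => w; rewrite minibatch_noise// dotvZr; congr (_ * _).
rewrite /noise_sum; elim/big_rec2: _ => [|i y1 y2 _ <-]; last by rewrite dotvDr.
by rewrite dotv0.
Qed.

End sampled.
End stochastic_gradients.

Lemma measurable_set_ltr {R : realType} d (T : measurableType d) (g h : T -> R) :
  measurable_fun setT g -> measurable_fun setT h ->
  measurable [set w | g w < h w].
Proof.
move=> mg mh; rewrite -[X in measurable X]setTI.
by have m := measurable_fun_ltr mg mh; exact: (m measurableT [set true]).
Qed.

Lemma measurable_set_ler {R : realType} d (T : measurableType d) (g h : T -> R) :
  measurable_fun setT g -> measurable_fun setT h ->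
  measurable [set w | g w <= h w].
Proof.
move=> mg mh; rewrite -[X in measurable X]setTI.
by have m := measurable_fun_ler mg mh; exact: (m measurableT [set true]).
Qed.

(** * Stopping above level 2 *)

Section stopped_process.
Context {R : realType} {T : Type}.
Variable rho : nat -> T -> R.

Fixpoint stopped (k : nat) (w : T) : R :=
  if k is k'.+1 then
    if stopped k' w <= 2 then rho k w else stopped k' w
  else rho 0 w.

(** A frozen value exceeds 2, so a value at most 2 shows that the process has not been stopped. *)
Lemma stopped_id k w : stopped k w <= 2 -> stopped k w = rho k w.
Proof. by case: k => [//|k] /=; case: ifP => // ->. Qed.

End stopped_process.

(** * Exponential moment of the stopped gap and the failure probability *)

Section high_probability.
Context {R : realType} {n : nat} {d : measure_display} {Xi : measurableType d}.
Variables (D : probability Xi R) (sigma : R).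
Variables (f : 'rV[R]_n -> R) (G : 'rV[R]_n -> Xi -> 'rV[R]_n).
Hypothesis SG : stochastic_gradient D sigma f G.
Variables (mu L : R) (x0 xs : 'rV[R]_n).
Hypotheses (mu0 : 0 < mu) (L0 : 0 < L) (muL : mu <= L).
Hypotheses (sc : strongly_convex mu f) (sm : smooth L f).
Hypothesis mn : forall y, f xs <= f y.
Let r0 := f x0 - f xs.
Hypothesis r0_gt0 : 0 < r0.
Variables (ell : R) (N : nat) (m : nat -> nat).
Hypotheses (ell2 : 2 <= ell) (N0 : (0 < N)%N).
Let gamma := (81 * L * ell)^-1.
Let q := 1 - gamma * mu.
Let lambda k := 4 * Num.sqrt (L * q ^+ k * r0).
Hypothesis m0 : forall k, (0 < m k)%N.
(** The left side bounds the mean of the quadratic remainder of [exp_gap_step] for a minibatch of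
    variance at most sigma^2 / m_k. Over [N] iterations the right sides add up to ell / 9. *)
Hypothesis m_large : forall k,
  3 * sigma ^+ 2 / ((m k)%:R * lambda k ^+ 2) <= ell / (9 * N%:R).

(** [s] separates the space of the iterate from that of the samples: it is [id] on a single space
    and [snd] on the product of past and fresh randomness. *)
Lemma measurable_minibatch d' d'' (T : measurableType d')
    (T' : measurableType d'') (X : T -> 'rV[R]_n)
    (xi : nat * nat -> T' -> Xi) (s : T -> T') k :
  measurable_rV X ->
  (forall i, (i < m k)%N -> measurable_fun setT (fun w => xi (k, i) (s w))) ->
  measurable_rV (fun w => minibatch_grad G m xi k (X w) (s w)).
Proof.
move=> mX mxi; apply: measurable_rVZ => //; apply: measurable_rV_sum => i.
apply: (measurable_stochastic_gradient SG) => //.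
exact: (mxi _ (ltn_ord i)).
Qed.

Let q_gt0 : 0 < q.
Proof.
have l2 := ell2; have mL := muL; have lp := L0.
rewrite /q subr_gt0 /gamma mulrC ltr_pdivrMr ?mul1r; last by rewrite !mulr_gt0//; lra.
have : L * 2 <= L * ell by rewrite ler_wpM2l// ltW.
lra.
Qed.

Let lambda_gt0 k : 0 < lambda k.
Proof. by rewrite mulr_gt0// sqrtr_gt0 !mulr_gt0// exprn_gt0. Qed.

Lemma measurable_clipped_sgd d' (T : measurableType d')
    (xi : nat * nat -> T -> Xi) k :
  (forall ki, (ki.1 < k)%N -> (ki.2 < m ki.1)%N -> measurable_fun setT (xi ki)) ->
  measurable_rV (clipped_sgd G x0 gamma lambda m xi k).
Proof.
elim: k => [_|k IH mxi /=]; first exact: measurable_rV_cst.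
have mX : measurable_rV (clipped_sgd G x0 gamma lambda m xi k).
  by apply: IH => ki h; apply: mxi; exact: ltn_trans h _.
apply: measurable_rVB => //; apply: measurable_rVZ => //.
apply: measurable_clip => //.
by apply: (measurable_minibatch (s := id)) => // i im; exact: mxi.
Qed.

Section run.
Context {dO : measure_display} {Omega : measurableType dO}.
Variables (P : probability Omega R) (xi : nat * nat -> Omega -> Xi).
Hypothesis iid : iid_samples P D N m xi.

Let S := [set ki : nat * nat | (ki.1 < N)%N /\ (ki.2 < m ki.1)%N].

Let mxi ki : S ki -> measurable_fun setT (xi ki).
Proof. by case: iid => h _ _; exact: h. Qed.

(** Integrate [exp_gap_step]: the linear term is centred, and [m_large] controls the variance
    term. *)
Lemma step_expectation x k : (k < N)%N -> f x - f xs <= 2 * q ^+ k * r0 ->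
  (\int[P]_w (expR (2 * ell *
     ((f (x - gamma *: clip (minibatch_grad G m xi k x w) (lambda k)) - f xs)
       / (q ^+ k.+1 * r0))))%:E <=
   (expR (2 * ell * ((f x - f xs) / (q ^+ k * r0))) * (1 + ell / (9 * N%:R)))%:E)%E.
Proof.
move=> kN gap; set E0 := expR _; set v := grad f x.
pose g w := minibatch_grad G m xi k x w.
have mg : measurable_rV g.
  apply: (measurable_minibatch (s := id)); first exact: measurable_rV_cst.
  by move=> i im; exact: mxi.
have mgv : measurable_rV (fun w => g w - v).
  by apply: measurable_rVB => //; exact: measurable_rV_cst.
have E00 : 0 <= E0 by exact: expR_ge0.
have Q0 : 0 < q ^+ k by rewrite exprn_gt0.
set A := 2 * ell * gamma / (q ^+ k * q * r0).
have [il l0] := centredZ (- (E0 * A)) (centred_minibatch SG iid x v kN (m0 k)).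
set B := E0 * (3 / lambda k ^+ 2).
have B0 : 0 <= B by rewrite mulr_ge0// divr_ge0// sqr_ge0.
have mB : measurable_fun setT (fun w => B * norm2 (g w - v) ^+ 2).
  by apply: measurable_funM => //; apply: measurable_funX; exact: measurable_norm2.
apply: (@le_trans _ _ (\int[P]_w (E0 + - (E0 * A) * dotv v (g w - v)
    + B * norm2 (g w - v) ^+ 2)%:E)%E).
  apply: ge0_le_integral => //.
  - apply/measurable_EFinP; apply: measurableT_comp => //.
    apply: measurable_funM => //; apply: measurable_funM => //.
    apply: measurable_funB => //.
    apply: measurable_continuous_rV; first exact: (smooth_continuous sm).
    apply: measurable_rVB; first exact: measurable_rV_cst.
    by apply: measurable_rVZ => //; exact: measurable_clip.
  - apply/measurable_EFinP; apply: measurable_funD => //.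
    by apply: measurable_funD => //; exact: centred_measurable (conj il l0).
  move=> w _; rewrite lee_fin exprSr.
  have := exp_gap_step (g w) mu0 L0 muL sc sm mn ell2 Q0 r0_gt0 gap.
  move=> /le_trans; apply; rewrite -/gamma -/q -/(lambda k) -/E0 -/A -/v /B.
  have alg (e a c b l : R) : e * (1 - a * c + 3 / l * b) =
    e + - (e * a) * c + e * (3 / l) * b by ring.
  by rewrite alg.
rewrite mulrDr mulr1.
apply: integral_affine_le => //.
  by move=> w; rewrite mulr_ge0// sqr_ge0.
under eq_integral do rewrite EFinM.
rewrite ge0_integralZl_EFin//; last 2 first.
- by move=> w _; rewrite lee_fin sqr_ge0.
- by apply/measurable_EFinP; apply: measurable_funX; exact: measurable_norm2.
apply: le_trans (lee_wpmul2l _ (minibatch_variance SG iid x kN (m0 k))) _.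
  by rewrite lee_fin.
rewrite -EFinM lee_fin /B -mulrA ler_wpM2l//; apply: le_trans (m_large k).
rewrite le_eqVlt; apply/orP; left; apply/eqP; field.
by rewrite gt_eqF//= pnatr_eq0 -lt0n m0.
Qed.

Let X k := clipped_sgd G x0 gamma lambda m xi k.
Let rho k w := (f (X k w) - f xs) / (q ^+ k * r0).
Let U := stopped rho.

Let measurable_stopped d' (T : measurableType d') (r : nat -> T -> R) k :
  (forall j, (j <= k)%N -> measurable_fun setT (r j)) ->
  measurable_fun setT (stopped r k).
Proof.
elim: k => [|k IH] mr /=; first exact: mr.
have mU : measurable_fun setT (stopped r k).
  by apply: IH => j jk; apply: mr; exact: leqW.
by apply: measurable_fun_ifT => //; [exact: measurable_fun_ler|exact: mr].
Qed.

Let measurable_rho d' (T : measurableType d') (Y : T -> 'rV[R]_n) k :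
  measurable_rV Y -> measurable_fun setT (fun w => (f (Y w) - f xs) / (q ^+ k * r0)).
Proof.
move=> mY; apply: measurable_funM => //; apply: measurable_funB => //.
by apply: measurable_continuous_rV => //; exact: (smooth_continuous sm).
Qed.

Let measurable_U k : (k <= N)%N -> measurable_fun [set: Omega] (U k).
Proof.
move=> kN; apply: measurable_stopped => j jk; apply: measurable_rho.
apply: measurable_clipped_sgd => ki kij kim; apply: mxi; split => //.
exact: leq_trans kij (leq_trans jk kN).
Qed.

(** Induction on [k], where [S1] indexes the past samples, which determine the iterate and the
    stopped process, and [S2] the fresh minibatch. *)
Lemma stopped_exponential_moment k : (k <= N)%N ->
  (\int[P]_w (expR (2 * ell * U k w))%:E <=
   (expR (2 * ell) * (1 + ell / (9 * N%:R)) ^+ k)%:E)%E.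
Proof.
have ell0 : 0 < ell by have := ell2; lra.
have eta0 : 0 <= 1 + ell / (9 * N%:R).
  by rewrite addr_ge0// divr_ge0 ?(ltW ell0)// mulr_ge0.
elim: k => [_|k IH kN].
  rewrite /U /rho /X /= expr0 mul1r divff ?gt_eqF// mulr1 integral_cst//.
  rewrite [X in (_ * X)%E](_ : _ = 1%E); last exact: probability_setT.
  by rewrite mulr1 mule1.
have [_ _ ind] := iid.
pose S1 : set (nat * nat) := [set ki | (ki.1 < k)%N /\ (ki.2 < m ki.1)%N].
pose S2 : set (nat * nat) := [set ki | ki.1 = k /\ (ki.2 < m k)%N].
have S1S : S1 `<=` S.
  by move=> [a b] [/= ak bp]; split => //=; apply: ltn_trans ak _.
have S2S : S2 `<=` S by move=> [a b] [/= -> ?].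
have S12 : S1 `&` S2 = set0.
  by apply/seteqP; split => // -[a b] [[/= h _] [/= e _]]; rewrite e ltnn in h.
pose T1 : measurableType _ := g_sigma_algebraType (cylinder xi S1).
pose T2 : measurableType _ := g_sigma_algebraType (cylinder xi S2).
have mX1 j : (j <= k)%N -> @measurable_rV _ _ _ T1 (X j).
  move=> jk; apply: (@measurable_clipped_sgd _ T1 xi) => ki kij kim.
  by apply: measurable_coordinate; split => //; exact: leq_trans kij jk.
have mU1 : measurable_fun [set: T1] (U k).
  by apply: (@measurable_stopped _ T1) => j jk; apply: measurable_rho; exact: mX1.
(* The first component feeds the iterate and the second the new samples; on the diagonal this is the
   next iterate. *)
pose next (z : T1 * T2) : 'rV[R]_n :=
  X k z.1 - gamma *: clip (minibatch_grad G m xi k (X k z.1) z.2) (lambda k).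
have mnext : measurable_rV next.
  have mX : measurable_rV (fun z : T1 * T2 => X k z.1).
    by move=> j; exact: (measurableT_comp (mX1 _ (leqnn k) j) measurable_fst).
  apply: measurable_rVB => //; apply: measurable_rVZ => //.
  apply: measurable_clip => //.
  apply: (@measurable_minibatch _ _ _ T2 _ xi snd) => // i im.
  apply: measurableT_comp => //; apply: measurable_coordinate.
  by split.
pose h (z : T1 * T2) := (expR (2 * ell * (if U k z.1 <= 2
  then (f (next z) - f xs) / (q ^+ k.+1 * r0) else U k z.1)))%:E.
have h0 z : (0 <= h z)%E by rewrite lee_fin expR_ge0.
have mU11 : measurable_fun [set: T1 * T2] (fun z => U k z.1).
  exact: (measurableT_comp mU1 measurable_fst).
have mh : measurable_fun setT h.
  apply/measurable_EFinP; apply: measurableT_comp => //.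
  apply: measurable_funM => //; apply: measurable_fun_ifT => //.
    exact: measurable_fun_ler.
  exact: measurable_rho.
have -> : (\int[P]_w (expR (2 * ell * U k.+1 w))%:E = \int[P]_w h (w, w))%E.
  by apply: eq_integral => w _; rewrite /h /U /=.
rewrite (independent_decoupling mxi ind S1S S2S S12 mh h0).
have meU : measurable_fun [set: Omega] (fun v => (expR (2 * ell * U k v))%:E).
  apply/measurable_EFinP; apply: measurableT_comp => //.
  by apply: measurable_funM => //; exact/measurable_U/ltnW.
apply: (@le_trans _ _ (\int[P]_v ((1 + ell / (9 * N%:R))%:E *
    (expR (2 * ell * U k v))%:E))%E).
  apply: ge0_le_integral => //.
  - by move=> v _; apply: integral_ge0.
  - apply: (g_sigma_cylinder_measurable_fun (S := S1) (xi := xi)).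
      by move=> i /S1S; exact: mxi.
    exact: (g_sigma_cylinder_integral_measurable P mxi S2S mh).
  - exact: measurable_funeM.
  move=> v _; rewrite -EFinM mulrC.
  (* Before stopping, the gap meets the hypothesis of [step_expectation]. After stopping, the
     integrand is constant and the factor is at least 1. *)
  have [U2|U2] := boolP (U k v <= 2).
    under eq_integral do rewrite /h U2.
    have Urho : U k v = rho k v by exact: stopped_id.
    have gap : f (X k v) - f xs <= 2 * q ^+ k * r0.
      move: U2; rewrite Urho /rho ler_pdivrMr ?mulrA//.
      by rewrite mulr_gt0// exprn_gt0.
    rewrite Urho /next; exact: (step_expectation kN gap).
  rewrite (_ : (fun w => h (v, w)) = cst (expR (2 * ell * U k v))%:E); last first.
    by apply/funext => w; rewrite /h (negbTE U2).
  rewrite integral_cst//.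
  rewrite [X in (_ * X)%E](_ : _ = 1%E); last exact: probability_setT.
  rewrite mule1 lee_fin ler_peMr ?expR_ge0// lerDl.
  by rewrite divr_ge0 ?(ltW ell0)// mulr_ge0.
rewrite ge0_integralZl_EFin//.
apply: le_trans (lee_wpmul2l _ (IH (ltnW kN))) _; first by rewrite lee_fin.
by rewrite -EFinM lee_fin exprS mulrCA.
Qed.

Lemma clipped_sgd_failure :
  (P [set w | (2 < U N w)%R] <= (expR (- ell))%:E)%E.
Proof.
have ell0 : 0 < ell by have := ell2; lra.
have NR : 0 < N%:R :> R by rewrite ltr0n.
have mU := measurable_U (leqnn N).
set A := [set w | _].
have mA : measurable A by exact: measurable_set_ltr.
have meU c : measurable_fun [set: Omega] (fun v => (expR (2 * ell * U N v - c))%:E).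
  apply/measurable_EFinP; apply: measurableT_comp => //.
  by apply: measurable_funB => //; apply: measurable_funM.
rewrite -[A]setIT -integral_indic//.
(* Markov's inequality: where U_N > 2 the exponent is positive, so the exponential dominates the
   indicator. *)
apply: (@le_trans _ _ (\int[P]_w (expR (2 * ell * U N w - 4 * ell))%:E)%E).
  apply: ge0_le_integral => //.
    by apply/measurable_EFinP; exact: measurable_indic.
  move=> w _; rewrite lee_fin indicE; case: (boolP (w \in A)) => [|_].
    rewrite inE /A /= => h; rewrite -[leLHS]expR0 ler_expR.
    have : ell * 2 <= ell * U N w by apply: ler_wpM2l; exact: ltW.
    by move: (U N w) => u; lra.
  exact: expR_ge0.
under eq_integral do rewrite addrC expRD EFinM.
rewrite ge0_integralZl_EFin ?expR_ge0//; last first.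
  by have := meU 0; under eq_fun do rewrite subr0.
apply: le_trans (lee_wpmul2l _ (stopped_exponential_moment (leqnn N))) _.
  by rewrite lee_fin expR_ge0.
rewrite -EFinM lee_fin.
have h1 : (1 + ell / (9 * N%:R)) ^+ N <= expR (ell / 9).
  have -> : ell / 9 = N%:R * (ell / (9 * N%:R)) by field; rewrite gt_eqF.
  rewrite expRM_natl.
  rewrite ler_pXn2r ?nnegrE ?expR_ge0 ?expR_ge1Dx//.
  by rewrite addr_ge0// divr_ge0 ?(ltW ell0)// mulr_ge0.
rewrite mulrA -expRD.
apply: le_trans (ler_wpM2l (expR_ge0 _) h1) _.
(* The exponents add up to - 4 ell + 2 ell + ell / 9, which is at most - ell. *)
rewrite -expRD ler_expR; lra.
Qed.

(** Outside the failure event the stopped process is the rescaled gap itself. The level [c] is 2 q^N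
    r0 for the first claim of the theorem and eps for the second. *)
Lemma clipped_sgd_success c : 2 * q ^+ N * r0 <= c ->
  ((1 - expR (- ell))%:E <= P [set w | (f (X N w) - f xs <= c)%R])%E.
Proof.
move=> qc; have mU := measurable_U (leqnn N).
pose A := [set w | 2 < U N w].
have mA : measurable A by exact: measurable_set_ltr.
apply: (@le_trans _ _ (P (~` A))).
  rewrite probability_setC// EFinB leeB//.
  exact: clipped_sgd_failure.
apply: le_measure; rewrite ?inE//.
- exact: measurableC.
- have mX : measurable_rV (X N) by apply: measurable_clipped_sgd => ki a b; exact: mxi.
  apply: measurable_set_ler => //; apply: measurable_funB => //.
  exact: measurable_continuous_rV (smooth_continuous sm) mX.
move=> w /negP; rewrite -leNgt => U2; move: (U2).
rewrite [U N w]stopped_id//= /rho ler_pdivrMr; last first.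
  by rewrite mulr_gt0// exprn_gt0.
by rewrite mulrA => /le_trans; apply.
Qed.

End run.
End high_probability.

(** * Number of iterations and of oracle calls *)

Section iteration_count.
Context {R : realType}.
Implicit Types (x mu L sigma beta eps : R) (N k : nat).

Lemma absz_ceil_ge x : 0 <= x -> x <= (absz (Num.ceil x))%:R.
Proof.
move=> x0; rewrite natr_absz ger0_norm ?ceil_ge//.
by rewrite ceil_ge0; apply: lt_le_trans x0.
Qed.

Lemma absz_ceil_le x : 0 <= x -> (absz (Num.ceil x))%:R <= x + 1.
Proof.
move=> x0; rewrite natr_absz ger0_norm; last first.
  by rewrite ceil_ge0; apply: lt_le_trans x0.
have := ceilB1_lt x; rewrite intrB; lra.
Qed.

Lemma batchsize_ge L mu sigma r0 beta N k :
  Num.max 1 (27 * N%:R * sigma ^+ 2 /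
    (16 * L * r0 * (1 - stepsize L beta N * mu) ^+ k * logfactor beta N))
  <= (batchsize L mu sigma r0 beta N k)%:R.
Proof. by apply: absz_ceil_ge; rewrite le_max ler01. Qed.

Lemma batchsize_gt0 L mu sigma r0 beta N k :
  (0 < batchsize L mu sigma r0 beta N k)%N.
Proof.
have := batchsize_ge L mu sigma r0 beta N k.
by rewrite ge_max => /andP[+ _]; rewrite ler1n.
Qed.

(** The bound 16 is what 4 N / beta exceeds as soon as N >= 4 and beta < 1; it comes from exp (1 /
    2) <= 2. *)
Lemma expR2_le16 : expR 2 <= 16 :> R.
Proof.
have h : expR (1 / 2) <= 2 :> R.
  apply: le_trans (expR_le_quadratic _) _; first by [].
  by rewrite expr2; lra.
have -> : 2 = 4%:R * (1 / 2) :> R by lra.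
rewrite expRM_natl; apply: (@le_trans _ _ (2 ^+ 4)).
  by rewrite ler_pXn2r ?nnegrE ?expR_ge0.
by rewrite -natrX.
Qed.

Lemma logfactor_ge2 beta N : 0 < beta < 1 -> (4 <= N)%N -> 2 <= logfactor beta N.
Proof.
move=> /andP[b0 b1] N4; rewrite /logfactor -[leLHS]expRK ler_ln ?posrE ?expR_gt0//.
  apply: le_trans expR2_le16 _; rewrite ler_pdivlMr//.
  have : 4 <= N%:R :> R by rewrite ler_nat.
  lra.
by rewrite divr_gt0// mulr_gt0// ltr0n (leq_trans _ N4).
Qed.

Lemma contraction_bounds L mu beta N : 0 < mu -> mu <= L ->
  2 <= logfactor beta N -> 0 < stepsize L beta N * mu <= 1 / 162.
Proof.
move=> mu0 muL l2; have L0 := lt_le_trans mu0 muL.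
have h : 0 < 81 * L * logfactor beta N by rewrite !mulr_gt0//; lra.
rewrite /stepsize mulr_gt0 ?invr_gt0//= mulrC ler_pdivrMr//.
have : L * 2 <= L * logfactor beta N by apply: ler_wpM2l => //; exact: ltW.
lra.
Qed.

Lemma logfactor_mono beta N N' : 0 < beta -> (0 < N)%N -> (N <= N')%N ->
  logfactor beta N <= logfactor beta N'.
Proof.
move=> b0 N0 NN; have N0' := leq_trans N0 NN.
rewrite /logfactor ler_ln ?posrE ?divr_gt0 ?mulr_gt0 ?ltr0n//.
by rewrite ler_wpM2r ?invr_ge0 ?(ltW b0)// ler_wpM2l// ler_nat.
Qed.

Lemma ln2_ge : 1 / 2 <= ln 2 :> R.
Proof.
rewrite -[leLHS]expRK ler_ln ?posrE ?expR_gt0//.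
apply: le_trans (expR_le_quadratic _) _; first by [].
by rewrite expr2; lra.
Qed.

(** The stepsize depends on [N] through the logarithm, so the condition on [N] is implicit. It is
    resolved by bounding that logarithm by 17 [Lam]; then N gamma mu >= E + 1, which makes q^N at
    most exp (- E - 1). *)
Lemma enough_iterations mu L (r0 : R) beta eps N :
  let q := 1 - stepsize L beta N * mu in
  let E := ln (r0 / eps) in
  let Lam := ln (L / (mu * beta) * E) in
  0 < mu -> mu <= L -> 0 < r0 -> 0 < beta < 1 ->
  0 < eps -> 2 <= E ->
  64 * 64 * (L / mu * (E * Lam)) <= N%:R <= 64 * 64 * (L / mu * (E * Lam)) + 1 ->
  [/\ (4 <= N)%N, N%:R <= 65 * 65 * (L / mu * (E * Lam)) &
      2 * q ^+ N * r0 <= eps].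
Proof.
move=> q E Lam mu0 muL r00 bb e0 E2 /andP[Nl Nu].
have qE : q = 1 - stepsize L beta N * mu by [].
have EE : E = ln (r0 / eps) by [].
have LamE : Lam = ln (L / (mu * beta) * E) by [].
clearbody q E Lam.
have /andP[b0 b1] := bb.
have L0 := lt_le_trans mu0 muL.
have [K KE] : exists K, K = L / mu by exists (L / mu).
rewrite -KE in Nl Nu *.
have K1 : 1 <= K by rewrite KE ler_pdivlMr ?mul1r.
have KE2 : 2 <= K * E by have := ler_pM ler01 (ler0n R 2) K1 E2; rewrite mul1r.
have [Q QE] : exists Q, Q = K * E / beta by exists (K * E / beta).
have {}LamE : Lam = ln Q.
  by rewrite LamE QE KE; congr ln; field; rewrite !gt_eqF.
have KEQ : K * E <= Q.
  by rewrite QE ler_pdivlMr// ler_piMr ?(ltW b1)//; exact: le_trans KE2.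
have Q2 : 2 <= Q by exact: le_trans KEQ.
have Q0 : 0 < Q by exact: lt_le_trans Q2.
have Lam2 : 1 / 2 <= Lam.
  by apply: le_trans ln2_ge _; rewrite LamE ler_ln ?posrE.
have LamQ : Lam <= Q by rewrite LamE; apply: ltW; exact: ln_sublinear.
have [Y YE] : exists Y, Y = K * E * Lam by exists (K * E * Lam).
rewrite [K * (E * Lam)]mulrA -YE in Nl Nu *.
have Y1 : 1 <= Y.
  have := ler_pM (ler0n R 2) (_ : 0 <= 1 / 2) KE2 Lam2; rewrite -YE; lra.
have N4 : (4 <= N)%N by rewrite -(ler_nat R); lra.
(* The rounding error 1 is absorbed since Y >= 1 and 65 * 65 exceeds 64 * 64 by more than 1. *)
have NY : N%:R <= 65 * 65 * Y by lra.
split => //.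
have N0 : 0 < N%:R :> R by rewrite ltr0n (leq_trans _ N4).
set l := logfactor beta N.
have l2 : 2 <= l by exact: logfactor_ge2.
(* 4 N / beta <= 2 ^ 15 Q ^ 2 <= Q ^ 17, the last step because Q >= 2. *)
have l17 : l <= 17 * Lam.
  have -> : 17 * Lam = ln (Q ^+ 17) by rewrite lnXn// -[RHS]mulr_natl LamE.
  rewrite /l /logfactor ler_ln ?posrE ?divr_gt0 ?mulr_gt0 ?exprn_gt0//.
  apply: (@le_trans _ _ (2 ^+ 15 * Q ^+ 2)).
    have YQ : Y <= K * E * Q by rewrite YE ler_wpM2l//; lra.
    rewrite ler_pdivrMr//.
    have -> : 2 ^+ 15 * Q ^+ 2 * beta = 2 ^+ 15 * (K * E * Q).
      by rewrite expr2 {1}QE; field; rewrite gt_eqF.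
    have -> : 2 ^+ 15 = 32 * 32 * 32 :> R by rewrite -!natrM -natrX.
    lra.
  rewrite (exprD _ 15 2) ler_wpM2r ?sqr_ge0//.
  by rewrite ler_pXn2r ?nnegrE// ltW.
have /andP[gm0 gm1] := contraction_bounds mu0 muL l2.
have qle : q <= expR (- (stepsize L beta N * mu)) by rewrite qE; exact: expR_ge1Dx.
have q0 : 0 <= q by rewrite qE; lra.
(* The additional 1 pays for the factor 2 of the conclusion, because 2 exp (- 1) <= 1. *)
have gN : E + 1 <= N%:R * (stepsize L beta N * mu).
  rewrite /stepsize -/l.
  have -> : N%:R * ((81 * L * l)^-1 * mu) = N%:R / (81 * K * l).
    by rewrite KE; field; rewrite !gt_eqF//; lra.
  have Kl : 0 < 81 * K * l by rewrite !mulr_gt0//; lra.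
  rewrite ler_pdivlMr//; apply: le_trans Nl.
  (* Here E >= 2 gives E + 1 <= 3 / 2 E, and 3 / 2 * 81 * 17 is below 64 * 64. *)
  have : (E + 1) * (81 * K * l) <= (3 / 2 * E) * (81 * K * (17 * Lam)).
    apply: ler_pM; [lra|exact: ltW|lra|].
    by apply: ler_wpM2l => //; rewrite mulr_ge0//; lra.
  move/le_trans; apply; rewrite YE.
  have : 0 <= K * E * Lam by rewrite !mulr_ge0//; lra.
  lra.
have qN : q ^+ N <= expR (- (E + 1)).
  apply: (@le_trans _ _ (expR (- (stepsize L beta N * mu)) ^+ N)).
    by apply: lerXn2r; rewrite ?nnegrE ?expR_ge0.
  by rewrite -expRM_natl mulrN ler_expR lerN2.
have eE : expR (- E) * r0 = eps.
  rewrite expRN EE lnK ?posrE ?divr_gt0//.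
  by field; rewrite !gt_eqF.
have e1 : 2 <= expR 1 :> R by have := expR_ge1Dx (1 : R); lra.
have eN1 : 2 * expR (- (1 : R)) <= 1.
  by rewrite expRN ler_pdivrMr ?expR_gt0// mul1r.
rewrite opprD expRD in qN.
rewrite -eE ler_wpM2r ?(ltW r00)//.
apply: le_trans (ler_wpM2l _ qN) _ => //.
rewrite mulrCA ler_piMr ?expR_ge0//.
Qed.

(* The number of iterations must not exceed what is needed, since the
   batchsizes grow like [q ^- k]; hence the least admissible [N]. *)
Lemma exists_iteration_count mu L (r0 : R) beta eps :
  let q N := 1 - stepsize L beta N * mu in
  let E := ln (r0 / eps) in
  let Lam := ln (L / (mu * beta) * E) in
  0 < mu -> mu <= L -> 0 < r0 ->
  0 < beta < 1 -> 0 < eps -> eps <= expR (- 2) * r0 ->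
  exists N, [/\ (4 <= N)%N, N%:R <= 65 * 65 * (L / mu * (E * Lam)),
    2 * q N ^+ N * r0 <= eps & eps <= 4 * q N ^+ N * r0].
Proof.
move=> q E Lam mu0 muL r00 bb e0 er.
have /andP[b0 b1] := bb.
have E2 : 2 <= E.
  rewrite /E -[leLHS]expRK ler_ln ?posrE ?expR_gt0 ?divr_gt0//.
  by rewrite ler_pdivlMr// mulrC -ler_pdivlMr ?expR_gt0// mulrC -expRN.
have L0 := lt_le_trans mu0 muL.
have Y0 : 0 <= 64 * 64 * (L / mu * (E * Lam)).
  have Lam0 : 0 <= Lam.
    rewrite ln_ge0//; have -> : L / (mu * beta) * E = L / mu * (E / beta).
      by field; rewrite !gt_eqF.
    apply: mulr_ege1; first by rewrite ler_pdivlMr ?mul1r.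
    rewrite ler_pdivlMr// mul1r; apply: le_trans (ltW b1) _.
    by apply: le_trans E2; rewrite ler1n.
  have E0 : 0 <= E by apply: le_trans E2.
  by rewrite !mulr_ge0 ?invr_ge0 ?(ltW L0) ?(ltW mu0).
have [N0 [N04 N0u N0e]] : exists N0, [/\ (4 <= N0)%N,
    N0%:R <= 65 * 65 * (L / mu * (E * Lam)) & 2 * q N0 ^+ N0 * r0 <= eps].
  exists (absz (Num.ceil (64 * 64 * (L / mu * (E * Lam))))).
  by apply: enough_iterations => //; rewrite absz_ceil_ge//= absz_ceil_le.
have qE k : q k = 1 - stepsize L beta k * mu by [].
clear Y0; clearbody q E Lam.
pose p N := (4 <= N)%N && (2 * q N ^+ N * r0 <= eps).
have exp : exists N, p N by exists N0; rewrite /p N04.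
have [N /andP[N4 Ne] Nmin] := ex_minnP exp.
have NN0 : (N <= N0)%N by apply: Nmin; rewrite /p N04.
have er1 : eps < r0.
  apply: le_lt_trans er _; rewrite gtr_pMl// -[ltRHS](@expR0 R) ltr_expR.
have qb k : (4 <= k)%N -> 161 / 162 <= q k.
  move=> k4; have := contraction_bounds mu0 muL (logfactor_ge2 bb k4).
  by rewrite qE; lra.
exists N; split => //.
  by apply: le_trans N0u; rewrite ler_nat.
case: N => [//|N'] in N4 Ne Nmin NN0 *.
(* The least [N] cannot be 4: four factors of at least 161 / 162 keep 2 q^4 r0 above r0 > eps. *)
have [N4'|N4'] := leqP 4 N'; last first.
  have N'3 : N' = 3 by apply/eqP; rewrite eqn_leq -ltnS N4'.
  exfalso; move: Ne; rewrite N'3; apply/negP; rewrite -ltNge.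
  apply: lt_le_trans er1 _; rewrite ler_peMl ?(ltW r00)//.
  have q4 := qb 4 isT.
  have : (161 / 162) ^+ 4 <= q 4 ^+ 4.
    have c0 : 0 <= 161 / 162 :> R by rewrite divr_ge0 ?ler0n.
    by apply: lerXn2r => //; rewrite nnegrE; exact: le_trans q4.
  move: (q 4 ^+ 4) => y; rewrite !exprS expr0; lra.
(* By minimality the bound fails at [N']. Since q increases with [N] and is at least 1 / 2, passing
   to the successor costs at most a factor 2. *)
have np : ~~ p N' by apply/negP => /Nmin; rewrite ltnn.
move: np; rewrite /p N4' /= -ltNge => /ltW /le_trans; apply.
rewrite ler_wpM2r ?(ltW r00)//.
have qq : q N' <= q N'.+1.
  rewrite !qE lerD2l lerN2 ler_wpM2r ?(ltW mu0)// /stepsize.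
  have l2 := logfactor_ge2 bb N4'; have l2' := logfactor_ge2 bb N4.
  rewrite lef_pV2 ?posrE ?mulr_gt0//; try lra.
  rewrite ler_wpM2l ?mulr_ge0 ?(ltW L0)//.
  by apply: logfactor_mono => //; exact: leq_trans N4'.
have q0 := qb _ N4'; have q1 := qb _ N4.
have h : q N' ^+ N' <= q N'.+1 ^+ N'.
  by apply: lerXn2r => //; rewrite nnegrE; lra.
have : q N'.+1 ^+ N' * (1 / 2) <= q N'.+1 ^+ N' * q N'.+1.
  by apply: ler_wpM2l; [apply: exprn_ge0|]; lra.
rewrite exprSr; move: h; move: (q N'.+1 ^+ N' * q N'.+1) (q N' ^+ N') (q N'.+1 ^+ N').
  by move=> t y z; lra.
Qed.

(** The batchsizes are at most 2 + c q^-k, and the geometric sum is at most q^-N / (1 - q). As 1 - q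
    = gamma mu, the factors [L] and [l] of [c] cancel, and q^-N <= 4 r0 / eps by the choice of
    [N]. *)
Lemma sum_batchsize_le mu L sigma r0 beta eps N : 0 < mu -> mu <= L ->
  0 < r0 -> 0 < eps -> 2 <= logfactor beta N ->
  let q := 1 - stepsize L beta N * mu in
  eps <= 4 * q ^+ N * r0 ->
  (\sum_(k < N) batchsize L mu sigma r0 beta N k)%:R <=
  N%:R * (2 + 27 * 81 / 4 * (sigma ^+ 2 / (mu * eps))).
Proof.
move=> mu0 muL r00 e0 l2 q qe.
have L0 := lt_le_trans mu0 muL.
have /andP[gm0 gm1] := contraction_bounds mu0 muL l2.
have q0 : 0 < q by rewrite /q; lra.
set l := logfactor beta N in l2 *.
have l0 : 0 < l by lra.
pose c := 27 * N%:R * sigma ^+ 2 / (16 * L * r0 * l).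
have c0 : 0 <= c.
  apply: divr_ge0; last by rewrite ltW// !mulr_gt0.
  exact: mulr_ge0 (mulr_ge0 (ler0n _ _) (ler0n _ _)) (sqr_ge0 _).
have mk k : (batchsize L mu sigma r0 beta N k)%:R <= 2 + c * q^-1 ^+ k.
  rewrite /batchsize -/q -/l.
  have -> : 27 * N%:R * sigma ^+ 2 / (16 * L * r0 * q ^+ k * l) = c * q^-1 ^+ k.
    by rewrite /c exprVn; field; rewrite !gt_eqF// exprn_gt0.
  have a0 : 0 <= c * q^-1 ^+ k.
    by rewrite mulr_ge0// exprn_ge0// invr_ge0 ltW.
  apply: le_trans (absz_ceil_le _) _; first by rewrite le_max ler01.
  have : Num.max 1 (c * q^-1 ^+ k) <= 1 + c * q^-1 ^+ k by rewrite ge_max; lra.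
  lra.
have geo : (1 - q) * \sum_(k < N) q^-1 ^+ k <= q^-1 ^+ N.
  have := subrX1 q^-1 N; move=> e.
  apply: (@le_trans _ _ ((q^-1 - 1) * \sum_(k < N) q^-1 ^+ k)).
    apply: ler_wpM2r; first by apply: sumr_ge0 => i _; rewrite exprn_ge0// invr_ge0 ltW.
    have -> : q^-1 - 1 = (1 - q) / q by field; rewrite gt_eqF.
    by rewrite ler_peMr ?invf_ge1//; rewrite /q; lra.
  by rewrite -e; lra.
have qN0 : 0 < q ^+ N by rewrite exprn_gt0.
have qeps : q^-1 ^+ N <= 4 * r0 / eps.
  rewrite exprVn ler_pdivlMr// mulrC ler_pdivrMr//.
  by move: qe; rewrite mulrAC.
have sumc : c * \sum_(k < N) q^-1 ^+ k <= N%:R * (27 * 81 / 4 * (sigma ^+ 2 / (mu * eps))).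
  have cE : c = 27 * 81 / 16 * N%:R * sigma ^+ 2 / (mu * r0) * (1 - q).
    by rewrite /c /q /stepsize -/l; field; rewrite !gt_eqF.
  have c1 : 0 <= 27 * 81 / 16 * N%:R * sigma ^+ 2 / (mu * r0).
    apply: divr_ge0; last by rewrite ltW// mulr_gt0.
    apply: mulr_ge0; last exact: sqr_ge0.
    by apply: mulr_ge0; last exact: ler0n; lra.
  rewrite cE -[leLHS]mulrA.
  apply: le_trans (ler_wpM2l c1 (le_trans geo qeps)) _.
  rewrite [X in X <= _](_ : _ = 27 * 81 / 4 * (N%:R * (sigma ^+ 2 / (mu * eps)))); last first.
    by field; rewrite !gt_eqF.
  by rewrite mulrCA.
rewrite natr_sum; apply: (@le_trans _ _ (\sum_(k < N) (2 + c * q^-1 ^+ k))).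
  by apply: ler_sum => i _; exact: mk.
rewrite big_split/= sumr_const card_ord -mulr_sumr [leRHS]mulrDr.
by apply: lerD => //; rewrite mulr_natl.
Qed.

End iteration_count.

Theorem theoremG3 (R : realType) :
  exists C : R, 0 < C /\
  forall (n : nat) (d : measure_display) (Xi : measurableType d)
    (D : probability Xi R) (f : 'rV[R]_n -> R) (G : 'rV[R]_n -> Xi -> 'rV[R]_n)
    (mu L sigma : R) (x0 xs : 'rV[R]_n),
  let r0 := f x0 - f xs in
  0 < mu -> 0 < L -> 0 <= sigma ->
  strongly_convex mu f -> smooth L f ->
  stochastic_gradient D sigma f G ->
  (forall x, f xs <= f x) -> 0 < r0 ->
  forall beta : R, 0 < beta < 1 ->
  let gamma N := stepsize L beta N in
  let lambda N := clip_level L mu r0 beta N in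
  let m N := batchsize L mu sigma r0 beta N in
  (forall N : nat, (1 <= N)%N -> 2 <= ln (4 * N%:R / beta) ->
    clipped_sgd_reaches D G x0 (gamma N) (lambda N) (m N) N (1 - beta)
      [set x | f x - f xs <= 2 * (1 - gamma N * mu) ^+ N * (f x0 - f xs)])
  /\
  (forall eps : R, 0 < eps <= expR (- 2) * r0 ->
    let logs := ln (r0 / eps) * ln (L / (mu * beta) * ln (r0 / eps)) in
    exists N : nat,
    [/\ (1 <= N)%N /\ 2 <= ln (4 * N%:R / beta),
        N%:R <= C * (L / mu * logs),
        (\sum_(k < N) m N k)%:R <=
          C * (Num.max (L / mu) (sigma ^+ 2 / (mu * eps) * (L / mu)) * logs) &
        clipped_sgd_reaches D G x0 (gamma N) (lambda N) (m N) N (1 - beta)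
          [set x | f x - f xs <= eps]]).
Proof.
(* 65 * 65 comes from the iteration count, the other factor from the mean batchsize. *)
exists (65 * 65 * (2 + 27 * 81 / 4)); split; first by lra.
move=> n d Xi D f G mu L sigma x0 xs r0 mu0 L0 sigma0 sc sm SG mn r00 beta bb
  gamma lambda m.
have /andP[b0 b1] := bb.
have muL : mu <= L := modulus_le_smoothness mu0 L0 sc sm mn r00.
have reach N c : (1 <= N)%N -> 2 <= logfactor beta N ->
    2 * (1 - gamma N * mu) ^+ N * r0 <= c ->
    clipped_sgd_reaches D G x0 (gamma N) (lambda N) (m N) N (1 - beta)
      [set x | f x - f xs <= c].
  move=> N1 l2 qc dO Omega P xi iid.
  have l0 : 0 < logfactor beta N by lra.
  have N0 : 0 < N%:R :> R by rewrite ltr0n.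
  have /andP[gm0 gm1] := contraction_bounds mu0 muL l2.
  have q0 : 0 < 1 - stepsize L beta N * mu by lra.
  (* As lambda_k^2 = 16 L q^k r0, this is the second lower bound in the definition of the batchsize,
     rearranged. *)
  have mlarge k : 3 * sigma ^+ 2 / ((m N k)%:R *
      (4 * Num.sqrt (L * (1 - stepsize L beta N * mu) ^+ k * r0)) ^+ 2)
      <= logfactor beta N / (9 * N%:R).
    have qk : 0 < (1 - stepsize L beta N * mu) ^+ k by rewrite exprn_gt0.
    have mk : 0 < (m N k)%:R :> R by rewrite ltr0n batchsize_gt0.
    rewrite exprMn sqr_sqrtr ?mulr_ge0 ?(ltW L0) ?(ltW qk) ?(ltW r00)//.
    have := batchsize_ge L mu sigma r0 beta N k.
    rewrite ge_max -/(m N k) => /andP[_].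
    move: ((1 - stepsize L beta N * mu) ^+ k) qk => Q qk.
    rewrite ler_pdivrMr ?mulr_gt0// => h.
    have -> : 4 ^+ 2 = 16 :> R by rewrite -natrX.
    rewrite ler_pdivrMr ?mulr_gt0// mulrAC ler_pdivlMr ?mulr_gt0//.
    by move: h; lra.
  apply: le_trans (clipped_sgd_success SG mu0 L0 muL sc sm mn r00 l2 N1
    (batchsize_gt0 _ _ _ _ _ _) mlarge iid qc).
  (* The failure probability exp (- ell) is beta / (4 N), which is at most beta. *)
  rewrite lee_fin lerD2l lerN2 expRN /logfactor lnK ?posrE ?divr_gt0 ?mulr_gt0//.
  rewrite invf_div ler_pdivrMr ?mulr_gt0// ler_peMr ?(ltW b0)//.
  have : 1 <= N%:R :> R by rewrite ler1n.
  lra.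
split => [N N1 l2|eps /andP[e0 er] logs]; first exact: reach.
have [N [N4 NC Ne eN]] := exists_iteration_count mu0 muL r00 bb e0 er.
have l2 := logfactor_ge2 bb N4.
have N1 : (1 <= N)%N by exact: leq_trans N4.
rewrite -/logs in NC.
have NR : 0 < N%:R :> R by rewrite ltr0n.
have K0 : 0 < L / mu by rewrite divr_gt0.
(* The sign of the logarithmic product is read off from its being an upper bound for a multiple of N
   > 0. *)
have Klogs : 0 <= L / mu * logs by lra.
have logs0 : 0 <= logs by rewrite -(pmulr_rge0 _ K0).
exists N; split => //; last exact: reach.
  apply: le_trans NC _; apply: ler_wpM2r => //; lra.
apply: le_trans (sum_batchsize_le sigma mu0 muL r00 e0 l2 eN) _.
set s := sigma ^+ 2 / (mu * eps).
have s0 : 0 <= s.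
  by apply: divr_ge0; [exact: sqr_ge0|rewrite ltW// mulr_gt0].
apply: (@le_trans _ _ (65 * 65 * (L / mu * logs) * (2 + 27 * 81 / 4 * s))).
  by apply: ler_wpM2r => //; lra.
have -> : 65 * 65 * (L / mu * logs) * (2 + 27 * 81 / 4 * s) =
  65 * 65 * ((2 * (L / mu) + 27 * 81 / 4 * (s * (L / mu))) * logs) by ring.
rewrite -[leRHS]mulrA; apply: ler_wpM2l => //.
rewrite [leRHS]mulrA; apply: ler_wpM2r => //.
have : L / mu <= Num.max (L / mu) (s * (L / mu)) by rewrite le_max lexx.
have : s * (L / mu) <= Num.max (L / mu) (s * (L / mu)) by rewrite le_max lexx orbT.
move: (Num.max _ _) => M; lra.
Qed.
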